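(* Let $n,k$ be integers with $0<k<n$ and let $b\in\mathbb{C}$. Let $$\varphi(z)=\frac{1}{2\pi i}\int_{C}\exp\left\{-wz+b\alpha w^{k+1}+\beta w^{n+1}\right\}\,dw,\qquad \alpha=\frac{(-1)^{k+1}}{k+1},\quad \beta=\frac{1}{n+1}.$$ Then the order of the entire function $\varphi$ satisfies $\rho(\varphi)=1+\frac1n$.
   Context: The contour $C$ runs from $\infty$ to $0$ along the ray $\arg w=-\pi/(n+1)$ and then from $0$ to $\infty$ along the ray $\arg w=\pi/(n+1)$. For an entire function $f$, $\rho(f)=\limsup_{r\to\infty}\frac{\log\log M(r,f)}{\log r}$ denotes its order, where $M(r,f)=\max_{|z|=r}|f(z)|$. *)

(* Defs.v *)
From HB Require Import structures.
From mathcomp Require Import all_boot all_order all_algebra.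
From mathcomp Require Import all_classical all_reals all_analysis.
From mathcomp Require Import complex.

Set Implicit Arguments.
Unset Strict Implicit.
Unset Printing Implicit Defensive.

Import numFieldNormedType.Exports.

Local Open Scope classical_set_scope.
Local Open Scope ring_scope.
Local Open Scope complex_scope.

Definition cexp (R : realType) (z : R[i]) : R[i] :=
  (expR (complex.Re z))%:C * (cos (complex.Im z) +i* sin (complex.Im z)).

(* A Lebesgue integral. It is applied to continuous f whose modulus is exp of
   - t^(n+1) / (n+1) + o(t^(n+1)), for which it coincides with the absolutely
   convergent improper integral. *)
Definition half_line_integral (R : realType) (f : R -> R[i]) : R[i] :=
  Rintegral lebesgue_measure `[0, +oo[ (fun t => complex.Re (f t)) +i*
  Rintegral lebesgue_measure `[0, +oo[ (fun t => complex.Im (f t)).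

(* The integral of f(w) dw from 0 to infinity along the ray arg w = theta,
   parametrized by w = t e^(i theta). *)
Definition ray_integral (R : realType) (theta : R) (f : R[i] -> R[i]) : R[i] :=
  half_line_integral
    (fun t => f (t%:C * cexp (theta *i)) * cexp (theta *i)).

(* The first ray is traversed inwards, whence the minus sign. *)
Definition contour_integral (R : realType) (n : nat) (f : R[i] -> R[i]) :
    R[i] :=
  - ray_integral (- (pi / n.+1%:R)) f + ray_integral (pi / n.+1%:R) f.

Definition phi (R : realType) (n k : nat) (b z : R[i]) : R[i] :=
  let alpha : R[i] := (-1) ^+ k.+1 / k.+1%:R in
  let beta : R[i] := 1 / n.+1%:R in
  1 / (2%:R * pi%:C * (0 +i* 1)) *
  contour_integral n (fun w =>
    cexp (- (w * z) + b * alpha * w ^+ k.+1 + beta * w ^+ n.+1)).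

Definition entire (R : realType) (f : R[i] -> R[i]) : Prop :=
  forall z : R[i], derivable (f : R[i]^o -> R[i]^o) z 1.

(* For entire f and r >= 0 the circle |z| = r is compact and nonempty, so that
   the supremum is a maximum. *)
Definition max_modulus (R : realType) (r : R) (f : R[i] -> R[i]) : R :=
  sup [set Normc.normc (f z) | z in [set z | Normc.normc z = r]].

(* [ln] is 0 on nonpositive arguments; as f is entire, this matters for large r
   only when f is a constant of modulus at most 1, which gets order 0. *)
Definition order_of_growth (R : realType) (f : R[i] -> R[i]) : \bar R :=
  limf_esup (fun r : R => (ln (ln (max_modulus r f)) / ln r)%:E)
    (pinfty_nbhs R).

(* Main.v *)
(* Write phi = (2 pi i)^-1 * int_C e^(-wz) g(w) dw, where
   g(w) = exp(b alpha w^(k+1) + beta w^(n+1)) has modulus at most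
   exp(B t^(k+1) - t^(n+1) / (n+1)) at distance t from 0 on the contour. The
   inequality r t <= A r^(1+1/n) + t^(n+1) / A^n then bounds log |phi(z)| by a
   multiple of |z|^(1+1/n).

   For the lower bound no asymptotics are needed. Up to constants the Taylor
   coefficients of phi are p_m = J_m / m!, where J_m = int_C w^m g(w) dw.
   Integrating the derivative of w^(m+1) g(w) gives
     (m+1) J_m + b (-1)^(k+1) J_(m+1+k) + J_(m+1+n) = 0.
   If the order were less than 1 + 1/n, Cauchy's estimates would give
   |p_m| <= K m^(-tau m) for some tau > n/(n+1). Read backwards, the recurrence
   contracts this weight by a factor 1/2 for large m, because tau (j+1) > j for
   j = n and for j = k, so iterating it yields J_m = 0 for all large m, and
   hence for all m. But then int_C f g = 0 for every entire f which is small
   enough compared with 1/g, and f(w) = exp(-b alpha w^(k+1)) gives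
   int_C exp(beta w^(n+1)) dw = 0, although this integral is a positive multiple
   of i sin(pi/(n+1)). *)
Require Import Defs.
From HB Require Import structures.
From mathcomp Require Import all_boot all_order all_algebra.
From mathcomp Require Import all_classical all_reals all_analysis.
From mathcomp Require Import complex measurable_realfun.
From mathcomp Require Import ring lra zify.
Set Implicit Arguments.
Unset Strict Implicit.
Unset Printing Implicit Defensive.
Import Order.TTheory GRing.Theory Num.Theory.
Import numFieldNormedType.Exports.
Local Open Scope classical_set_scope.
Local Open Scope complex_scope.
Local Open Scope ring_scope.
Local Notation Re := complex.Re.
Local Notation Im := complex.Im.
Local Notation normc := Normc.normc.

(** * Real part, imaginary part and modulus *)

Lemma cReD (R : realType) (z w : R[i]) : Re (z + w) = Re z + Re w.
Proof. by case: z w => [a b] [c d]. Qed.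

Lemma cImD (R : realType) (z w : R[i]) : Im (z + w) = Im z + Im w.
Proof. by case: z w => [a b] [c d]. Qed.

Lemma cReN (R : realType) (z : R[i]) : Re (- z) = - Re z.
Proof. by case: z => [a b]. Qed.

Lemma cImN (R : realType) (z : R[i]) : Im (- z) = - Im z.
Proof. by case: z => [a b]. Qed.

Lemma cReM (R : realType) (z w : R[i]) : Re (z * w) = Re z * Re w - Im z * Im w.
Proof. by case: z w => [a b] [c d]. Qed.

Lemma cImM (R : realType) (z w : R[i]) : Im (z * w) = Re z * Im w + Im z * Re w.
Proof. by case: z w => [a b] [c d]. Qed.

Lemma complex_ext (R : realType) (z w : R[i]) :
  Re z = Re w -> Im z = Im w -> z = w.
Proof. by case: z w => [a b] [c d] /= -> ->. Qed.

Lemma normc_ge0 (R : realType) (z : R[i]) : 0 <= normc z.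
Proof. by case: z => a b; exact: sqrtr_ge0. Qed.

Lemma normc_sqr (R : realType) (z : R[i]) :
  normc z ^+ 2 = Re z ^+ 2 + Im z ^+ 2.
Proof. by case: z => a b /=; rewrite sqr_sqrtr// addr_ge0 ?sqr_ge0. Qed.

Lemma normr_Re_le (R : realType) (z : R[i]) : `|Re z| <= normc z.
Proof.
case: z => a b /=; rewrite -sqrtr_sqr ler_sqrt ?lerDl ?sqr_ge0//.
by rewrite addr_ge0 ?sqr_ge0.
Qed.

Lemma normr_Im_le (R : realType) (z : R[i]) : `|Im z| <= normc z.
Proof.
case: z => a b /=; rewrite -sqrtr_sqr ler_sqrt ?lerDr ?sqr_ge0//.
by rewrite addr_ge0 ?sqr_ge0.
Qed.

Lemma normc_le_ReIm (R : realType) (z : R[i]) : normc z <= `|Re z| + `|Im z|.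
Proof.
rewrite -(@ler_pXn2r _ 2) ?nnegrE ?addr_ge0 ?normc_ge0//.
rewrite normc_sqr sqrrD !real_normK ?num_real//.
by rewrite lerD2r lerDl mulrn_wge0// mulr_ge0.
Qed.

Lemma normcX (R : realType) (z : R[i]) m : normc (z ^+ m) = normc z ^+ m.
Proof.
elim: m => [|m IH]; first by rewrite !expr0 Normc.normc1.
by rewrite !exprS Normc.normcM IH.
Qed.

Lemma normc_real (R : realType) (x : R) : normc x%:C = `|x|.
Proof. by rewrite /= expr0n addr0 sqrtr_sqr. Qed.

Lemma natrC (R : realType) m : (m%:R : R[i]) = (m%:R : R)%:C.
Proof. by rewrite rmorph_nat. Qed.

Lemma normc_nat (R : realType) m : normc (m%:R : R[i]) = m%:R.
Proof. by rewrite natrC normc_real normr_nat. Qed.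

Lemma normc_sum (R : realType) (I : finType) (F : I -> R[i]) :
  normc (\sum_i F i) <= \sum_i normc (F i).
Proof.
apply: (big_ind2 (fun x y => normc x <= y)) => // [|x1 x2 y1 y2 h1 h2].
  by rewrite Normc.normc0.
by apply: le_trans (le_normcD _ _) _; exact: lerD.
Qed.

(** * The complex exponential *)

Lemma cexpD (R : realType) (z w : R[i]) : cexp (z + w) = cexp z * cexp w.
Proof.
case: z w => [a b] [c d]; rewrite /cexp /= expRD cosD sinD.
by apply: complex_ext; rewrite !(cReM, cImM)/=; ring.
Qed.

Lemma cexp0 (R : realType) : cexp (0 : R[i]) = 1.
Proof. by rewrite /cexp /= expR0 cos0 sin0 mul1r. Qed.

Lemma cexpMn (R : realType) (z : R[i]) m : cexp (z *+ m) = cexp z ^+ m.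
Proof.
elim: m => [|m IH]; first by rewrite mulr0n cexp0 expr0.
by rewrite mulrS cexpD IH exprS.
Qed.

Lemma normc_cexp (R : realType) (z : R[i]) : normc (cexp z) = expR (Re z).
Proof.
rewrite /cexp Normc.normcM normc_real gtr0_norm ?expR_gt0//=.
by rewrite cos2Dsin2 sqrtr1 mulr1.
Qed.

Lemma normc_cexp_le (R : realType) (z : R[i]) :
  normc (cexp z) <= expR (normc z).
Proof. by rewrite normc_cexp ler_expR (le_trans (ler_norm _)) ?normr_Re_le. Qed.

Lemma normc_cexp_imag (R : realType) (x : R) : normc (cexp (x *i)) = 1.
Proof. by rewrite normc_cexp/= expR0. Qed.

(* [R[i]] is not a normed module over [R], so complex-valued functions of a real
   variable are differentiated componentwise. *)
Definition cder (R : realType) (f : R -> R[i]) (t : R) (d : R[i]) :=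
  is_derive t 1 (fun x => Re (f x)) (Re d) /\
  is_derive t 1 (fun x => Im (f x)) (Im d).

Lemma cder_ext (R : realType) (f g : R -> R[i]) t d :
  f =1 g -> cder f t d -> cder g t d.
Proof. by move=> /funext ->. Qed.

Lemma cder_eq (R : realType) (f : R -> R[i]) t d e :
  d = e -> cder f t d -> cder f t e.
Proof. by move=> ->. Qed.

Lemma cder_cst (R : realType) (c : R[i]) t : cder (fun=> c) t 0.
Proof. by split; exact: is_derive_cst. Qed.

Lemma cder_id (R : realType) (t : R) : cder (fun x => x%:C) t 1.
Proof. by split; [exact: is_derive_id|exact: is_derive_cst]. Qed.

Lemma cderD (R : realType) (f g : R -> R[i]) t d e :
  cder f t d -> cder g t e -> cder (fun x => f x + g x) t (d + e).
Proof.
move=> [f1 f2] [g1 g2]; split.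
- rewrite (_ : (fun _ => _) = (fun x => Re (f x)) + (fun x => Re (g x)));
    last by apply/funext => x; rewrite cReD.
  by rewrite cReD; exact: is_deriveD.
- rewrite (_ : (fun _ => _) = (fun x => Im (f x)) + (fun x => Im (g x)));
    last by apply/funext => x; rewrite cImD.
  by rewrite cImD; exact: is_deriveD.
Qed.

Lemma cderM (R : realType) (f g : R -> R[i]) t d e :
  cder f t d -> cder g t e -> cder (fun x => f x * g x) t (d * g t + f t * e).
Proof.
move=> [f1 f2] [g1 g2]; split.
- rewrite (_ : (fun _ => _) = (fun x => Re (f x)) * (fun x => Re (g x)) -
      (fun x => Im (f x)) * (fun x => Im (g x))); last first.
    by apply/funext => x; rewrite cReM.
  apply: is_derive_eq; rewrite !(cReD, cReM) /GRing.scale /=; ring.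
- rewrite (_ : (fun _ => _) = (fun x => Re (f x)) * (fun x => Im (g x)) +
      (fun x => Im (f x)) * (fun x => Re (g x))); last first.
    by apply/funext => x; rewrite cImM.
  apply: is_derive_eq; rewrite !(cImD, cImM) /GRing.scale /=; ring.
Qed.

Lemma cderZ (R : realType) (f : R -> R[i]) t d c :
  cder f t d -> cder (fun x => c * f x) t (c * d).
Proof.
move=> fd; apply: cder_eq (cderM (cder_cst c t) fd).
by rewrite mul0r add0r.
Qed.

Lemma cderX (R : realType) (f : R -> R[i]) t d m :
  cder f t d -> cder (fun x => f x ^+ m) t (m%:R * f t ^+ m.-1 * d).
Proof.
move=> fd; elim: m => [|m IH].
  by rewrite !mul0r; exact: cder_cst.
apply: (@cder_ext _ (fun x => f x * f x ^+ m)) => [x|]; first by rewrite exprS.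
apply: cder_eq (cderM fd IH).
case: m {IH} => [|m]; first by rewrite /= !expr0; ring.
by rewrite /= exprS -[m.+2%:R]natr1; ring.
Qed.

Lemma cder_ray (R : realType) (e : R[i]) (t : R) :
  cder (fun x : R => x%:C * e) t e.
Proof.
apply: cder_eq (cderM (cder_id t) (cder_cst e t)).
by rewrite mulr0 addr0 mul1r.
Qed.

Lemma cder_cexp (R : realType) (f : R -> R[i]) t d :
  cder f t d -> cder (fun x => cexp (f x)) t (cexp (f t) * d).
Proof.
move=> [f1 f2]; split.
- rewrite (_ : (fun _ => _) = (expR \o (fun x => Re (f x))) *
      (cos \o (fun x => Im (f x)))); last first.
    by apply/funext => x; rewrite /cexp cReM/= mul0r subr0.
  have h1 := is_derive1_comp (is_derive_expR (Re (f t))) f1.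
  have h2 := is_derive1_comp (is_derive_cos (Im (f t))) f2.
  apply: is_derive_eq; rewrite /cexp !(cReM, cImM) /GRing.scale /=; ring.
- rewrite (_ : (fun _ => _) = (expR \o (fun x => Re (f x))) *
      (sin \o (fun x => Im (f x)))); last first.
    by apply/funext => x; rewrite /cexp cImM/= mul0r addr0.
  have h1 := is_derive1_comp (is_derive_expR (Re (f t))) f1.
  have h2 := is_derive1_comp (is_derive_sin (Im (f t))) f2.
  apply: is_derive_eq; rewrite /cexp !(cReM, cImM) /GRing.scale /=; ring.
Qed.

(** * Taylor expansion of the exponential *)

Lemma pow_fact_le_expR (R : realType) (x : R) N : 0 <= x ->
  x ^+ N / N`!%:R <= expR x.
Proof.
case: N => [|N] x0; first by rewrite expr0 fact0 divr1 -expR0 ler_expR.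
by apply: le_trans (expR_ge1Dxn N x0); rewrite lerDr.
Qed.

Lemma derivable_continuous (R : realType) (f df : R -> R) :
  (forall t : R, is_derive t 1 f (df t)) -> continuous f.
Proof.
move=> fd t; apply: differentiable_continuous; apply/derivable1_diffP.
by have [] := fd t.
Qed.

Lemma le_of_derive (R : realType) (f df : R -> R) t :
  0 <= t -> (forall s : R, is_derive s 1 f (df s)) ->
  (forall s, 0 <= s <= t -> 0 <= df s) -> f 0 <= f t.
Proof.
move=> t0 fd fp; rewrite -subr_ge0.
have [|s] := @MVT_segment R f df 0 t t0 (fun s _ => fd s).
  by apply: continuous_subspaceT; exact: derivable_continuous fd.
by rewrite in_itv/= => st ->; rewrite mulr_ge0 ?fp// subr0.
Qed.

Definition exp_poly (R : realType) N (x : R[i]) : R[i] :=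
  \sum_(m < N) x ^+ m / m`!%:R.

Lemma exp_polyS (R : realType) N (x : R[i]) :
  exp_poly N.+1 x = exp_poly N x + x ^+ N / N`!%:R.
Proof. by rewrite /exp_poly big_ord_recr. Qed.

Lemma exp_poly0 (R : realType) (x : R[i]) : exp_poly 0 x = 0.
Proof. by rewrite /exp_poly big_ord0. Qed.

Lemma exp_poly_at0 (R : realType) N : exp_poly N.+1 (0 : R[i]) = 1.
Proof.
elim: N => [|N IH].
  by rewrite exp_polyS exp_poly0 expr0 fact0 divr1 add0r.
by rewrite exp_polyS IH expr0n/= mul0r addr0.
Qed.

Lemma cder_exp_poly (R : realType) N (x : R[i]) (t : R) :
  cder (fun s => exp_poly N.+1 (s%:C * x)) t (x * exp_poly N (t%:C * x)).
Proof.
elim: N => [|N IH].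
  apply: (@cder_ext _ (fun=> 1)).
    by move=> s; rewrite exp_polyS exp_poly0 expr0 fact0 divr1 add0r.
  by rewrite exp_poly0 mulr0; exact: cder_cst.
apply: (@cder_ext _ (fun s => exp_poly N.+1 (s%:C * x) +
    (N.+1`!%:R)^-1 * (s%:C * x) ^+ N.+1)).
  by move=> s; rewrite [RHS]exp_polyS [_ * (s%:C * x) ^+ _]mulrC.
apply: cder_eq (cderD IH (cderZ _ (cderX N.+1 (cder_ray x t)))).
rewrite exp_polyS mulrDr; congr (_ + _).
rewrite factS natrM invfM /=.
have : (N.+1%:R : R[i]) != 0 by rewrite pnatr_eq0.
have : (N`!%:R : R[i]) != 0 by rewrite pnatr_eq0 -lt0n fact_gt0.
move: (N.+1%:R : R[i]) (N`!%:R : R[i]) (_ ^+ N) => u v y h1 h2.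
by field; rewrite h1 h2.
Qed.

Lemma cder_cexp_line (R : realType) (x : R[i]) (t : R) :
  cder (fun s => cexp (s%:C * x)) t (x * cexp (t%:C * x)).
Proof.
by apply: cder_eq (cder_cexp (cder_ray x t)); rewrite mulrC.
Qed.

(* Quantifying over the functionals [Re (c * _)] makes the induction go through
   on real functions without losing a constant. *)
Lemma Re_exp_rem_le (R : realType) (x : R[i]) N (c : R[i]) (t : R) :
  0 <= t <= 1 ->
  Re (c * (cexp (t%:C * x) - exp_poly N (t%:C * x))) <=
  normc c * expR (normc x) * ((normc x * t) ^+ N / N`!%:R).
Proof.
elim: N c t => [|N IH] c t t01; have /andP[t0 t1] := t01.
  rewrite exp_poly0 subr0 expr0 fact0 divr1 mulr1.
  apply: le_trans (ler_norm _) _; apply: le_trans (normr_Re_le _) _.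
  rewrite Normc.normcM ler_wpM2l ?normc_ge0//.
  apply: le_trans (normc_cexp_le _) _.
  by rewrite ler_expR Normc.normcM normc_real ger0_norm// ler_piMl ?normc_ge0.
pose M := normc c * expR (normc x).
(* [G] is the right side minus the left side. It vanishes at 0, and its derivative [dG] is
   nonnegative by the induction hypothesis for the constant [c * x]. *)
pose G (s : R) := M * ((normc x * s) ^+ N.+1 / N.+1`!%:R) -
  Re (c * (cexp (s%:C * x) - exp_poly N.+1 (s%:C * x))).
pose dG (s : R) := M * (normc x * ((normc x * s) ^+ N / N`!%:R)) -
  Re (c * x * (cexp (s%:C * x) - exp_poly N (s%:C * x))).
have G0 : G 0 = 0.
  rewrite /G !mul0r exp_poly_at0 cexp0 subrr !mulr0 expr0n/=.
  by rewrite !(mul0r, mulr0) subrr.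
rewrite -subr_ge0 -/M -/(G t) -G0; apply: (le_of_derive (df := dG)) => // s.
  have [h _] :
    cder (fun s => c * (cexp (s%:C * x) - exp_poly N.+1 (s%:C * x))) s
      (c * x * (cexp (s%:C * x) - exp_poly N (s%:C * x))).
    apply: (@cder_ext _ (fun s => c * (cexp (s%:C * x) +
       (-1) * exp_poly N.+1 (s%:C * x)))) => [r|]; first by rewrite mulN1r.
    apply: cder_eq (cderZ _ (cderD (cder_cexp_line x s)
      (cderZ (-1) (cder_exp_poly N x s)))).
    by ring.
  have h' : is_derive s 1 (fun s : R => M * ((normc x * s) ^+ N.+1 / N.+1`!%:R))
      (M * (normc x * ((normc x * s) ^+ N / N`!%:R))).
    rewrite (_ : (fun _ => _) =
      (M * normc x ^+ N.+1 / N.+1`!%:R) *: (id ^+ N.+1)); last first.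
      apply/funext => r /=; rewrite /GRing.scale/= exprMn.
      rewrite (_ : (id ^+ N.+1 : R -> R) r = r ^+ N.+1) ?fctE//.
      by rewrite !mulrA mulrAC.
    apply: is_derive_eq; rewrite /GRing.scale/= mulr1 exprMn.
    rewrite factS natrM invfM exprS.
    have : (N.+1%:R : R) != 0 by rewrite pnatr_eq0.
    have : (N`!%:R : R) != 0 by rewrite pnatr_eq0 -lt0n fact_gt0.
    by move: (N.+1%:R : R) (N`!%:R : R) => u v h1 h2; field; rewrite h1 h2.
  exact: is_deriveB.
move=> /andP[s0 st]; rewrite subr_ge0.
apply: le_trans (IH _ _ _) _; first by rewrite s0 (le_trans st).
by rewrite Normc.normcM /M !mulrA [_ * normc x * expR _]mulrAC.
Qed.

(** With the conjugate of the remainder as the constant [c] and [t = 1], the left side of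
    [Re_exp_rem_le] is the squared modulus of the remainder; one factor cancels. *)
Lemma exp_rem_le (R : realType) (x : R[i]) N :
  normc (cexp x - exp_poly N x) <= normc x ^+ N / N`!%:R * expR (normc x).
Proof.
set r := cexp x - _.
have [r0|r0] := eqVneq (normc r) 0.
  by rewrite r0 mulr_ge0 ?expR_ge0// divr_ge0// exprn_ge0// normc_ge0.
have rp : 0 < normc r by rewrite lt_def r0 normc_ge0.
have := @Re_exp_rem_le _ x N (r^*)%C 1; rewrite ler01 lexx mul1r mulr1 -/r.
have -> : normc (r^*)%C = normc r by case: (r) => a b /=; rewrite sqrrN.
have -> : Re ((r^*)%C * r) = normc r ^+ 2.
  by rewrite normc_sqr; case: (r) => a b /=; rewrite mulNr opprK !expr2.
move=> /(_ isT); rewrite expr2 -mulrA ler_pM2l// => h.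
by apply: le_trans h _; rewrite mulrC.
Qed.

(** Since |x|^N / N! = 2^-N (2|x|)^N / N! <= 2^-N exp(2|x|), the remainder decays geometrically in
    N, at the price of a tripled exponent. *)
Lemma exp_rem_le_geom (R : realType) (x : R[i]) N :
  normc (cexp x - exp_poly N x) <= 2^-1 ^+ N * expR (3 * normc x).
Proof.
apply: le_trans (exp_rem_le _ _) _.
have -> : 3 * normc x = 2 * normc x + normc x by ring.
rewrite expRD mulrA ler_wpM2r ?expR_ge0//.
have -> : normc x ^+ N / N`!%:R = 2^-1 ^+ N * ((2 * normc x) ^+ N / N`!%:R).
  by rewrite exprMn !mulrA -exprMn mulVf ?expr1n ?mul1r// pnatr_eq0.
by rewrite ler_wpM2l ?exprn_ge0 ?invr_ge0// pow_fact_le_expR// mulr_ge0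
  ?normc_ge0.
Qed.

(** * Integrals over a half-line *)

Local Notation halfline := (`[0, +oo[%classic).

Lemma is_derive_expRN (R : realType) (t : R) :
  is_derive t 1 (fun x : R => expR (- x)) (- expR (- t)).
Proof.
have h : is_derive t 1 (fun x : R => - x) (-1 : R).
  by apply: is_deriveN.
apply: is_derive_eq (is_derive1_comp (is_derive_expR (- t)) h) _.
by rewrite mulrN1.
Qed.

Lemma continuous_expRN (R : realType) : continuous (fun t : R => expR (- t)).
Proof. exact: derivable_continuous (@is_derive_expRN R). Qed.

Lemma integral_halfline_ge0 (R : realType) (f F : R -> R) :
  continuous f -> (forall t, 0 <= t -> 0 <= f t) ->
  (forall t : R, is_derive t 1 F (f t)) -> F t @[t --> +oo%R] --> (0 : R) ->
  (\int[lebesgue_measure]_(t in halfline) (f t)%:E = (- F 0)%:E)%E.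
Proof.
move=> cf f0 dF F0.
rewrite (@ge0_continuous_FTC2y _ f F 0 0)//.
- by rewrite -EFinD add0r.
- exact: continuous_subspaceT.
- by apply: cvg_at_right_filter; exact: (derivable_continuous dF).
- by move=> t _; rewrite derive1E; have [] := dF t.
Qed.

Lemma integral_expRN (R : realType) :
  (\int[lebesgue_measure]_(t in halfline) (expR (- t : R))%:E = 1)%E.
Proof.
have dF (t : R) : is_derive t 1 (fun t : R => - expR (- t)) (expR (- t)).
  rewrite -[X in is_derive _ _ _ X]opprK.
  by apply: is_deriveN; exact: is_derive_expRN.
rewrite (integral_halfline_ge0 (@continuous_expRN R) _ dF).
- by rewrite oppr0 expR0 opprK.
- by move=> t _; exact: expR_ge0.
- by rewrite -oppr0; apply: cvgN; exact: cvgr_expR.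
Qed.

(** The common majorant of all half-line integrals: exp(-t) has integral 1, so [C] also bounds the
    integral. *)
Definition exp_dom (R : realType) (C : R) (f : R -> R) :=
  forall t, 0 <= t -> `|f t| <= C * expR (- t).

Lemma integrable_expRN (R : realType) (C : R) :
  lebesgue_measure.-integrable halfline (EFin \o (fun t : R => C * expR (- t))).
Proof.
apply: (@integrableZl _ _ _ lebesgue_measure halfline _ C
  (fun t : R => (expR (- t))%:E)) => //.
apply/integrableP; split.
  apply/measurable_EFinP/measurable_funTS.
  exact: (continuous_measurable_fun (@continuous_expRN R)).
under eq_integral do rewrite /= ger0_norm ?expR_ge0//.
by rewrite integral_expRN ltry.
Qed.

Lemma integrable_exp_dom (R : realType) (C : R) (f : R -> R) :
  continuous f -> exp_dom C f ->
  lebesgue_measure.-integrable halfline (EFin \o f).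
Proof.
move=> cf fC; apply: le_integrable (integrable_expRN C) => //.
  by apply/measurable_EFinP/measurable_funTS; exact: continuous_measurable_fun.
move=> t /=; rewrite in_itv/= andbT => t0.
by rewrite lee_fin (le_trans (fC _ t0))// ler_norm.
Qed.

Lemma Rintegral_expRN (R : realType) (C : R) :
  \int[lebesgue_measure]_(t in halfline) (C * expR (- t)) = C.
Proof.
rewrite RintegralZl//; last first.
  have := integrable_expRN (1 : R).
  by rewrite (_ : EFin \o _ = EFin \o (fun t : R => expR (- t)))//;
    apply/funext => t /=; rewrite mul1r.
by rewrite /Rintegral integral_expRN mulr1.
Qed.

Lemma normr_Rintegral_le (R : realType) (C : R) (f : R -> R) :
  continuous f -> exp_dom C f ->
  `|\int[lebesgue_measure]_(t in halfline) f t| <= C.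
Proof.
move=> cf fC; rewrite -[leRHS]Rintegral_expRN.
have fi := integrable_exp_dom cf fC.
apply: le_trans (le_normr_Rintegral _ fi) _ => //.
apply: le_Rintegral => //.
- exact: (integrable_norm fi).
- exact: integrable_expRN.
- by move=> t; rewrite /= in_itv/= andbT; exact: fC.
Qed.

(* Adding [C * expR (- t)] to [f] reduces to the nonnegative case. *)
Lemma Rintegral_derive (R : realType) (C : R) (f F : R -> R) :
  continuous f -> (forall t : R, is_derive t 1 F (f t)) ->
  exp_dom C f -> exp_dom C F ->
  \int[lebesgue_measure]_(t in halfline) f t = - F 0.
Proof.
move=> cf dF fC FC.
pose h (t : R) := f t + C * expR (- t).
pose H (t : R) := F t + (- C) * expR (- t).
have dE (c t : R) :
    is_derive t 1 (fun t : R => c * expR (- t)) (- (c * expR (- t))).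
  rewrite -mulrN (_ : (fun _ => _) = c *: (fun t : R => expR (- t)))//.
  by apply: is_deriveZ; exact: is_derive_expRN.
have cE c : continuous (fun t : R => c * expR (- t)).
  exact: derivable_continuous (dE c).
have fi := integrable_exp_dom cf fC.
have gi := integrable_expRN C.
suff : \int[lebesgue_measure]_(t in halfline) h t = - F 0 + C.
  rewrite /h RintegralD// Rintegral_expRN.
  by move=> /(addIr C).
have dH (t : R) : is_derive t 1 H (h t).
  by have := is_deriveD (dF t) (dE (- C) t); rewrite mulNr opprK.
have ch : continuous h by move=> t; apply: cvgD; [exact: cf|exact: cE].
rewrite /Rintegral (integral_halfline_ge0 ch _ dH).
- by rewrite /H oppr0 expR0 mulr1 opprD opprK.
- move=> t t0; rewrite /h addrC -[f t]opprK subr_ge0.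
  by apply: le_trans (fC t t0); rewrite -normrN ler_norm.
- have E0 c : c * expR (- t) @[t --> +oo%R] --> (0 : R).
    by rewrite -(mulr0 c); apply: cvgM; [exact: cvg_cst|exact: cvgr_expR].
  rewrite -(addr0 0); apply: cvgD => //.
  apply: norm_cvg0.
  apply: (@squeeze_cvgr _ _ _ _ (fun=> 0) (fun t => C * expR (- t))) => //;
    last exact: cvg_cst.
  near=> t; rewrite normr_ge0 FC//.
Unshelve. all: by end_near. Qed.

(** Differentiability is stable under the operations used below and yields continuity, hence
    measurability, of both components. *)
Definition smooth (R : realType) (f : R -> R[i]) :=
  forall t, exists d, cder f t d.

Lemma smooth_continuous (R : realType) (f : R -> R[i]) : smooth f ->
  continuous (fun t => Re (f t)) /\ continuous (fun t => Im (f t)).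
Proof.
by move=> sf; split=> t; apply: differentiable_continuous;
  apply/derivable1_diffP; have [d [[? _] [? _]]] := sf t.
Qed.

Definition cexp_dom (R : realType) (C : R) (f : R -> R[i]) :=
  forall t, 0 <= t -> normc (f t) <= C * expR (- t).

Lemma cexp_domP (R : realType) (C : R) (f : R -> R[i]) : cexp_dom C f ->
  exp_dom C (fun t => Re (f t)) /\ exp_dom C (fun t => Im (f t)).
Proof.
by move=> fC; split=> t t0; apply: le_trans (fC t t0);
  [exact: normr_Re_le|exact: normr_Im_le].
Qed.

Lemma half_line_integralD (R : realType) (C D : R) (f g : R -> R[i]) :
  smooth f -> smooth g -> cexp_dom C f -> cexp_dom D g ->
  half_line_integral (fun t => f t + g t) =
  half_line_integral f + half_line_integral g.
Proof.
move=> /smooth_continuous[f1 f2] /smooth_continuous[g1 g2].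
move=> /cexp_domP[F1 F2] /cexp_domP[G1 G2].
apply: complex_ext; rewrite ?(cReD, cImD) /half_line_integral/=.
- under eq_Rintegral do rewrite cReD.
  by apply: RintegralD => //;
    [exact: integrable_exp_dom f1 F1|exact: integrable_exp_dom g1 G1].
- under eq_Rintegral do rewrite cImD.
  by apply: RintegralD => //;
    [exact: integrable_exp_dom f2 F2|exact: integrable_exp_dom g2 G2].
Qed.

Lemma half_line_integralZ (R : realType) (C : R) (c : R[i]) (f : R -> R[i]) :
  smooth f -> cexp_dom C f ->
  half_line_integral (fun t => c * f t) = c * half_line_integral f.
Proof.
move=> /smooth_continuous[f1 f2] /cexp_domP[F1 F2].
have i1 := integrable_exp_dom f1 F1; have i2 := integrable_exp_dom f2 F2.
have iZ (a : R) g : lebesgue_measure.-integrable halfline (EFin \o g) ->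
    lebesgue_measure.-integrable halfline (EFin \o (fun t : R => a * g t)).
  move=> gi.
  by apply: (@integrableZl _ _ _ lebesgue_measure halfline _ a (EFin \o g)).
apply: complex_ext; rewrite ?(cReM, cImM) /half_line_integral/=.
- under eq_Rintegral do rewrite cReM.
  rewrite RintegralB//; [|exact: iZ|exact: iZ].
  by rewrite !RintegralZl.
- under eq_Rintegral do rewrite cImM.
  rewrite RintegralD//; [|exact: iZ|exact: iZ].
  by rewrite !RintegralZl.
Qed.

(** The factor 2 comes from estimating the real and imaginary parts separately. *)
Lemma normc_half_line_integral_le (R : realType) (C : R) (f : R -> R[i]) :
  smooth f -> cexp_dom C f -> normc (half_line_integral f) <= 2 * C.
Proof.
move=> /smooth_continuous[f1 f2] /cexp_domP[F1 F2].
apply: le_trans (normc_le_ReIm _) _.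
rewrite (mulrDl 1 1) mul1r lerD//; exact: normr_Rintegral_le.
Qed.

Lemma half_line_integral_derive (R : realType) (C : R) (f F : R -> R[i]) :
  smooth f -> (forall t, cder F t (f t)) -> cexp_dom C f -> cexp_dom C F ->
  half_line_integral f = - F 0.
Proof.
move=> /smooth_continuous[f1 f2] dF /cexp_domP[c1 c2] /cexp_domP[C1 C2].
apply: complex_ext; rewrite ?(cReN, cImN) /half_line_integral/=.
- apply: (Rintegral_derive (F := fun t => Re (F t)) f1 _ c1 C1) => t.
  by have [] := dF t.
- apply: (Rintegral_derive (F := fun t => Im (F t)) f2 _ c2 C2) => t.
  by have [] := dF t.
Qed.

(** * Integrals over the contour *)

(* Both rays of the contour have a direction [e] with [e ^+ n.+1 = -1]. *)
Definition contour_dom (R : realType) n (C : R) (f : R[i] -> R[i]) :=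
  forall (e : R[i]) t, normc e = 1 -> e ^+ n.+1 = -1 -> 0 <= t ->
    normc (f (t%:C * e)) <= C * expR (- t).

Definition ray_smooth (R : realType) (f : R[i] -> R[i]) :=
  forall e, smooth (fun t => f (t%:C * e)).

Lemma ray_smooth_cst (R : realType) (c : R[i]) : ray_smooth (fun=> c).
Proof. by move=> e t; exists 0; exact: cder_cst. Qed.

Lemma ray_smooth_id (R : realType) : ray_smooth (fun w : R[i] => w).
Proof. by move=> e t; exists e; exact: cder_ray. Qed.

Lemma ray_smoothD (R : realType) (f g : R[i] -> R[i]) :
  ray_smooth f -> ray_smooth g -> ray_smooth (fun w => f w + g w).
Proof.
move=> sf sg e t; have [d fd] := sf e t; have [d' gd] := sg e t.
by eexists; exact: cderD fd gd.
Qed.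

Lemma ray_smoothM (R : realType) (f g : R[i] -> R[i]) :
  ray_smooth f -> ray_smooth g -> ray_smooth (fun w => f w * g w).
Proof.
move=> sf sg e t; have [d fd] := sf e t; have [d' gd] := sg e t.
by eexists; exact: cderM fd gd.
Qed.

Lemma ray_smoothX (R : realType) (f : R[i] -> R[i]) m :
  ray_smooth f -> ray_smooth (fun w => f w ^+ m).
Proof.
by move=> sf e t; have [d fd] := sf e t; eexists; exact: cderX fd.
Qed.

Lemma ray_smooth_cexp (R : realType) (f : R[i] -> R[i]) :
  ray_smooth f -> ray_smooth (fun w => cexp (f w)).
Proof.
by move=> sf e t; have [d fd] := sf e t; eexists; exact: cder_cexp fd.
Qed.

Lemma ray_smooth_exp_poly (R : realType) (f : R[i] -> R[i]) N :
  ray_smooth f -> ray_smooth (fun w => exp_poly N (f w)).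
Proof.
move=> sf; elim: N => [|N IH].
  rewrite (_ : (fun _ => _) = fun=> 0); first exact: ray_smooth_cst.
  by apply/funext => w; rewrite exp_poly0.
rewrite (_ : (fun _ => _) = fun w => exp_poly N (f w) + f w ^+ N * (N`!%:R)^-1).
  apply: ray_smoothD => //; apply: ray_smoothM; last exact: ray_smooth_cst.
  exact: ray_smoothX.
by apply/funext => w; rewrite exp_polyS.
Qed.

(** [s = true] is the ray traversed inwards, at angle -pi/(n+1); [s = false] is the outward one. *)
Definition ray_dir (R : realType) n (s : bool) : R[i] :=
  cexp (((-1) ^+ s * (pi / n.+1%:R) : R) *i).

Lemma ray_dirX (R : realType) n (s : bool) : ray_dir R n s ^+ n.+1 = -1.
Proof.
rewrite /ray_dir -cexpMn.
have -> : ((-1) ^+ s * (pi / n.+1%:R) : R) *i *+ n.+1 = ((-1) ^+ s * pi : R) *i.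
  rewrite -[LHS]mulr_natl natrC.
  apply: complex_ext; rewrite ?(cReM, cImM)/= !(mul0r, mulr0, subrr)//.
  rewrite addr0; have : (n.+1%:R : R) != 0 by rewrite pnatr_eq0.
  by move: (n.+1%:R : R) => u u0; field.
rewrite /cexp /= expR0 mul1r; apply: complex_ext => /=.
  by case: s; rewrite ?expr1 ?expr0 ?mulN1r ?mul1r ?cosN cospi.
by case: s; rewrite ?expr1 ?expr0 ?mulN1r ?mul1r ?sinN sinpi !oppr0.
Qed.

Definition ray_pull (R : realType) n (f : R[i] -> R[i]) (s : bool) (t : R) :=
  f (t%:C * ray_dir R n s) * ray_dir R n s.

Lemma contour_integralE (R : realType) n (f : R[i] -> R[i]) :
  contour_integral n f =
  - half_line_integral (ray_pull n f true) +
  half_line_integral (ray_pull n f false).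
Proof.
by rewrite /contour_integral /ray_integral /ray_pull /ray_dir expr1 expr0 mulN1r
  mul1r.
Qed.

Lemma ray_integrand (R : realType) n (C : R) (f : R[i] -> R[i]) s :
  ray_smooth f -> contour_dom n C f ->
  smooth (ray_pull n f s) /\ cexp_dom C (ray_pull n f s).
Proof.
move=> sf fC; have e1 : normc (ray_dir R n s) = 1 by exact: normc_cexp_imag.
split=> [t|t t0].
  have [d fd] := sf (ray_dir R n s) t.
  by eexists; exact: cderM fd (cder_cst _ _).
by rewrite /ray_pull Normc.normcM e1 mulr1 fC// ray_dirX.
Qed.

Lemma contour_integralD (R : realType) n (C D : R) (f g : R[i] -> R[i]) :
  ray_smooth f -> ray_smooth g -> contour_dom n C f -> contour_dom n D g ->
  contour_integral n (fun w => f w + g w) =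
  contour_integral n f + contour_integral n g.
Proof.
move=> sf sg fC gD; rewrite !contour_integralE.
have H s : half_line_integral (ray_pull n (fun w => f w + g w) s) =
    half_line_integral (ray_pull n f s) + half_line_integral (ray_pull n g s).
  have [s1 d1] := ray_integrand s sf fC; have [s2 d2] := ray_integrand s sg gD.
  rewrite -(half_line_integralD s1 s2 d1 d2); congr half_line_integral.
  by apply/funext => t; rewrite /ray_pull mulrDl.
by rewrite !H opprD addrACA.
Qed.

Lemma contour_integralZ (R : realType) n (C : R) c (f : R[i] -> R[i]) :
  ray_smooth f -> contour_dom n C f ->
  contour_integral n (fun w => c * f w) = c * contour_integral n f.
Proof.
move=> sf fC; rewrite !contour_integralE.
have H s : half_line_integral (ray_pull n (fun w => c * f w) s) =
    c * half_line_integral (ray_pull n f s).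
  have [s1 d1] := ray_integrand s sf fC.
  rewrite -(half_line_integralZ c s1 d1); congr half_line_integral.
  by apply/funext => t; rewrite /ray_pull mulrA.
by rewrite !H mulrDr mulrN.
Qed.

Lemma normc_contour_integral_le (R : realType) n (C : R) (f : R[i] -> R[i]) :
  ray_smooth f -> contour_dom n C f -> normc (contour_integral n f) <= 4 * C.
Proof.
move=> sf fC; rewrite contour_integralE.
have [s1 d1] := ray_integrand true sf fC.
have [s2 d2] := ray_integrand false sf fC.
apply: le_trans (le_normcD _ _) _; rewrite normcN.
have -> : 4 * C = 2 * C + 2 * C by ring.
by rewrite lerD// normc_half_line_integral_le.
Qed.

(** Both rays end at 0, where each contributes -F(0); they are traversed in opposite directions, so
    the contributions cancel. *)
Lemma contour_integral_derive (R : realType) n (C : R) (f F : R[i] -> R[i]) :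
  ray_smooth f -> contour_dom n C f -> contour_dom n C F ->
  (forall e t, cder (fun t => F (t%:C * e)) t (f (t%:C * e) * e)) ->
  contour_integral n f = 0.
Proof.
move=> sf fC FC dF; rewrite contour_integralE.
have H s : half_line_integral (ray_pull n f s) = - F 0.
  have [s1 d1] := ray_integrand s sf fC.
  pose G t := F (t%:C * ray_dir R n s).
  have -> : F 0 = G 0 by rewrite /G mul0r.
  apply: (half_line_integral_derive s1 _ d1) => [t|t t0]; first exact: dF.
  by apply: FC => //; [exact: normc_cexp_imag|exact: ray_dirX].
by rewrite !H addNr.
Qed.

Lemma contour_dom0 (R : realType) n : contour_dom n 0 (fun=> 0 : R[i]).
Proof. by move=> e t _ _ _; rewrite Normc.normc0 mul0r. Qed.

Lemma contour_domD (R : realType) n (C D : R) (f g : R[i] -> R[i]) :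
  contour_dom n C f -> contour_dom n D g ->
  contour_dom n (C + D) (fun w => f w + g w).
Proof.
move=> fC gD e t e1 en t0; apply: le_trans (le_normcD _ _) _.
by rewrite mulrDl lerD ?fC ?gD.
Qed.

Lemma contour_domZ (R : realType) n (C : R) c (f : R[i] -> R[i]) :
  contour_dom n C f -> contour_dom n (normc c * C) (fun w => c * f w).
Proof.
move=> fC e t e1 en t0; rewrite Normc.normcM -mulrA.
by rewrite ler_wpM2l ?normc_ge0 ?fC.
Qed.

(** * Growth of the integrand along the contour *)

(** Up to T = 1 + K / eps the left side is at most its value at T; beyond T both K <= eps t and
    t^(j+1) <= t^(n+1) hold. *)
Lemma pow_dom (R : realType) (K eps : R) j n : 0 <= K -> 0 < eps ->
  (j <= n)%N ->
  exists C, forall t, 0 <= t -> K * t ^+ j <= C + eps * t ^+ n.+1.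
Proof.
move=> K0 eps0 jn; pose T := 1 + K / eps.
have T1 : 1 <= T by rewrite lerDl divr_ge0// ltW.
exists (K * T ^+ j) => t t0.
have [tT|/ltW Tt] := leP t T.
  apply: ler_wpDr; first by rewrite mulr_ge0 ?exprn_ge0// ltW.
  by rewrite ler_wpM2l// lerXn2r// nnegrE (le_trans t0).
have t1 : 1 <= t by exact: le_trans Tt.
apply: ler_wpDl; first by rewrite mulr_ge0// exprn_ge0// (le_trans ler01).
apply: (@le_trans _ _ (eps * t * t ^+ j)).
  rewrite ler_wpM2r ?exprn_ge0// mulrC -ler_pdivrMr//.
  by apply: le_trans Tt; rewrite lerDr.
by rewrite -mulrA -exprS ler_wpM2l ?(ltW eps0)// ler_weXn2l.
Qed.

(** Here rho stands for |z|^(1/n). If t <= A rho, the first term on the right suffices; otherwise A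
    rho^n <= (A rho)^n <= t^n, and the second one does. *)
Lemma mul_pow_le (R : realType) (rho t A : R) n : 0 <= rho -> 0 <= t ->
  1 <= A ->
  (0 < n)%N -> rho ^+ n * t <= A * rho ^+ n.+1 + A^-1 * t ^+ n.+1.
Proof.
move=> r0 t0 A1 n0; have A0 : 0 < A by exact: lt_le_trans A1.
have [tT|/ltW Tt] := leP t (A * rho).
  apply: ler_wpDr; first by rewrite mulr_ge0 ?exprn_ge0// invr_ge0 ltW.
  by rewrite exprSr mulrCA ler_wpM2l// exprn_ge0.
apply: ler_wpDl; first by rewrite mulr_ge0 ?exprn_ge0// ltW.
rewrite exprSr mulrA ler_wpM2r//.
rewrite -ler_pdivrMl ?invr_gt0// invrK.
apply: (@le_trans _ _ ((A * rho) ^+ n));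
  last by rewrite lerXn2r// nnegrE mulr_ge0// ltW.
rewrite exprMn ler_wpM2r ?exprn_ge0//.
by case: n n0 => // n _; rewrite exprS ler_peMr ?(ltW A0)// exprn_ege1.
Qed.

(** With A = 4(n+1), the decay t^(n+1)/(n+1) consists of four copies of t^(n+1)/A. Three of them
    absorb rho^n t, B t^(k+1) and the t on the right, which produces the majorant exp(-t). *)
Lemma exponent_growth (R : realType) n k (B : R) : (k < n)%N -> 0 <= B ->
  exists C, forall rho t, 0 <= rho -> 0 <= t ->
    rho ^+ n * t + B * t ^+ k.+1 - t ^+ n.+1 / n.+1%:R <=
    C + 4 * n.+1%:R * rho ^+ n.+1 - t.
Proof.
move=> kn B0; pose A : R := 4 * n.+1%:R.
have A1 : 1 <= A by rewrite /A -natrM ler1n.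
have A0 : 0 < A by exact: lt_le_trans A1.
have Ai : 0 < A^-1 by rewrite invr_gt0.
have [C1 h1] := @pow_dom R B A^-1 k.+1 n B0 Ai kn.
have [C2 h2] := @pow_dom R 1 A^-1 1 n ler01 Ai (leq_ltn_trans (leq0n k) kn).
exists (C1 + C2) => rho t r0 t0.
have := mul_pow_le r0 t0 A1 (leq_ltn_trans (leq0n k) kn).
have := h1 _ t0; have := h2 _ t0; rewrite expr1 mul1r -/A.
have -> : t ^+ n.+1 / n.+1%:R = 4 * (A^-1 * t ^+ n.+1).
  rewrite /A; have : (n.+1%:R : R) != 0 by rewrite pnatr_eq0.
  by move: (n.+1%:R : R) (t ^+ _) => u v u0; field.
have : 0 <= A^-1 * t ^+ n.+1 by rewrite mulr_ge0 ?invr_ge0 ?exprn_ge0// ltW.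
by move: (A^-1 * _) (A * _) => u v; lra.
Qed.

Definition alpha (R : realType) k : R[i] := (-1) ^+ k.+1 / k.+1%:R.

(** The factor of the integrand that is free of z; [transform] below is 2 pi i times [phi]. *)
Definition ckernel (R : realType) n k (b w : R[i]) : R[i] :=
  cexp (b * alpha R k * w ^+ k.+1 + 1 / n.+1%:R * w ^+ n.+1).

Definition transform (R : realType) n k (b z : R[i]) : R[i] :=
  contour_integral n (fun w => cexp (- z * w) * ckernel n k b w).

Definition inv_2ipi (R : realType) : R[i] := 1 / (2%:R * pi%:C * (0 +i* 1)).

Lemma phiE (R : realType) n k (b z : R[i]) :
  phi n k b z = inv_2ipi R * transform n k b z.
Proof.
congr (_ * contour_integral n _); apply/funext => w.
by rewrite /ckernel -cexpD addrA mulNr [w * z]mulrC.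
Qed.

Lemma inv_2ipi_neq0 (R : realType) : inv_2ipi R != 0.
Proof.
rewrite /inv_2ipi div1r invr_eq0 !mulf_neq0 ?pnatr_eq0//.
  by rewrite eq_complex/= gt_eqF// pi_gt0.
by rewrite eq_complex/= oner_eq0 andbF.
Qed.

Lemma ray_smooth_kernel (R : realType) n k (b : R[i]) :
  ray_smooth (ckernel n k b).
Proof.
apply: ray_smooth_cexp; apply: ray_smoothD; apply: ray_smoothM;
  [exact: ray_smooth_cst|exact: ray_smoothX (@ray_smooth_id R)|
   exact: ray_smooth_cst|exact: ray_smoothX (@ray_smooth_id R)].
Qed.

Lemma normc_ray (R : realType) (e : R[i]) t m : normc e = 1 -> 0 <= t ->
  normc ((t%:C * e) ^+ m) = t ^+ m.
Proof.
by move=> e1 t0; rewrite normcX Normc.normcM e1 mulr1 normc_real ger0_norm.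
Qed.

(** As e^(n+1) = -1, the term in w^(n+1) is the real number -t^(n+1)/(n+1); the other term is
    bounded by its modulus. *)
Lemma normc_kernel_le (R : realType) n k (b e : R[i]) t :
  normc e = 1 -> e ^+ n.+1 = -1 -> 0 <= t ->
  normc (ckernel n k b (t%:C * e)) <=
  expR (normc (b * alpha R k) * t ^+ k.+1 - t ^+ n.+1 / n.+1%:R).
Proof.
move=> e1 en t0; rewrite normc_cexp ler_expR cReD lerD//.
  apply: le_trans (ler_norm _) _; apply: le_trans (normr_Re_le _) _.
  by rewrite Normc.normcM normc_ray.
rewrite exprMn en mulrN1 mulrN cReN lerN2 div1r natrC.
rewrite -(rmorphXn (real_complex R)) -(fmorphV (real_complex R)).
by rewrite -(rmorphM (real_complex R)) /= mulrC.
Qed.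

(** [C] is chosen before [K], [rho] and [f], so that the growth in [rho] is explicit; rho^n plays
    the role of |z|. The term with [B] admits factors such as exp(c w^(k+1)). *)
Lemma kernel_dom (R : realType) n k (b : R[i]) (B : R) : (k < n)%N -> 0 <= B ->
  exists C, 0 <= C /\ forall K rho f, 0 <= K -> 0 <= rho ->
    (forall e t, normc e = 1 -> 0 <= t ->
       normc (f (t%:C * e)) <= K * expR (rho ^+ n * t + B * t ^+ k.+1)) ->
    contour_dom n (K * (C * expR (4 * n.+1%:R * rho ^+ n.+1)))
      (fun w => f w * ckernel n k b w).
Proof.
move=> kn B0.
have [|C hC] := @exponent_growth R n k (B + normc (b * alpha R k)) kn.
  by rewrite addr_ge0 ?normc_ge0.
exists (expR C); split; first exact: expR_ge0.
move=> K rho f K0 r0 fK e t e1 en t0; rewrite Normc.normcM.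
apply: le_trans (ler_pM (normc_ge0 _) (normc_ge0 _) (fK _ _ e1 t0)
  (normc_kernel_le _ _ e1 en t0)) _.
rewrite -!mulrA ler_wpM2l// -!expRD ler_expR.
by have := hC _ _ r0 t0; rewrite mulrDl !addrA !mulrA.
Qed.

(** * Moments of the kernel *)

Definition moment (R : realType) n k (b : R[i]) m : R[i] :=
  contour_integral n (fun w => w ^+ m * ckernel n k b w).

Lemma ray_smooth_monomial (R : realType) n k (b : R[i]) m :
  ray_smooth (fun w => w ^+ m * ckernel n k b w).
Proof.
by apply: ray_smoothM;
  [exact: ray_smoothX (@ray_smooth_id R)|exact: ray_smooth_kernel].
Qed.

Lemma monomial_dom (R : realType) n k (b : R[i]) m : (k < n)%N ->
  exists C, contour_dom n C (fun w => w ^+ m * ckernel n k b w).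
Proof.
move=> kn; have [C [C0 hC]] := kernel_dom b kn (lexx 0).
(* On the contour |w^m| = t^m <= m! exp(t), which is the case rho = 1. *)
exists (m`!%:R * (C * expR (4 * n.+1%:R * 1 ^+ n.+1))).
apply: hC => // e t e1 t0; rewrite normc_ray// expr1n mul1r mul0r addr0.
by have := pow_fact_le_expR m t0; rewrite ler_pdivrMr ?ltr0n ?fact_gt0// mulrC.
Qed.

(** Termwise integration. The domination is carried through the induction because
    [contour_integralD] asks for it. *)
Lemma contour_integral_exp_poly (R : realType) n k (b c : R[i]) j N :
  (k < n)%N ->
  (exists C,
    contour_dom n C (fun w => exp_poly N (c * w ^+ j) * ckernel n k b w)) /\
  contour_integral n (fun w => exp_poly N (c * w ^+ j) * ckernel n k b w) =
  \sum_(m < N) c ^+ m / m`!%:R * moment n k b (j * m).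
Proof.
move=> kn; elim: N => [|N [[C hC] IH]].
  rewrite big_ord0.
  have -> : (fun w => exp_poly 0 (c * w ^+ j) * ckernel n k b w) = fun=> 0.
    by apply/funext => w; rewrite exp_poly0 mul0r.
  have d0 := @contour_dom0 R n; split; first by exists 0.
  apply: (contour_integral_derive (C := 0) (F := fun=> 0)) => //.
  - exact: ray_smooth_cst.
  - by move=> e t; rewrite mul0r; exact: cder_cst.
have [D hD] := @monomial_dom R n k b (j * N) kn.
have -> : (fun w => exp_poly N.+1 (c * w ^+ j) * ckernel n k b w) =
    (fun w => exp_poly N (c * w ^+ j) * ckernel n k b w +
      c ^+ N / N`!%:R * (w ^+ (j * N) * ckernel n k b w)).
  apply/funext => w; rewrite exp_polyS mulrDl; congr (_ + _).
  by rewrite exprMn exprM; ring.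
have hDZ := contour_domZ (c ^+ N / N`!%:R) hD.
have sm := @ray_smooth_monomial R n k b (j * N).
split; first by eexists; exact: contour_domD hC hDZ.
rewrite (contour_integralD _ _ hC hDZ).
- by rewrite big_ord_recr /= -IH (contour_integralZ _ sm hD).
- apply: ray_smoothM; last exact: ray_smooth_kernel.
  apply: ray_smooth_exp_poly; apply: ray_smoothM; first exact: ray_smooth_cst.
  exact: ray_smoothX (@ray_smooth_id R).
- by apply: ray_smoothM => //; exact: ray_smooth_cst.
Qed.

(* Used with [j = 1] for the Taylor expansion in [z], and with [j = k.+1] to
   remove the term of degree [k.+1] from the exponent of the kernel. *)
Lemma contour_integral_exp_approx (R : realType) n k (b : R[i]) j (M r B : R) :
  (k < n)%N -> 0 <= r -> 0 <= B ->
  (forall t, 0 <= t -> 3 * M * t ^+ j <= r ^+ n * t + B * t ^+ k.+1) ->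
  exists C, forall c, normc c <= M ->
  contour_dom n C (fun w => cexp (c * w ^+ j) * ckernel n k b w) /\
  forall N, normc
    (contour_integral n (fun w => cexp (c * w ^+ j) * ckernel n k b w) -
     \sum_(m < N) c ^+ m / m`!%:R * moment n k b (j * m)) <= 2^-1 ^+ N * C.
Proof.
move=> kn r0 B0 MrB; have [C [C0 hC]] := kernel_dom b kn B0.
pose D := C * expR (4 * n.+1%:R * r ^+ n.+1).
have D0 : 0 <= D by rewrite mulr_ge0 ?expR_ge0.
(* The 4 is that of [normc_contour_integral_le]; as D <= 4 D, the same constant serves for the
   domination. *)
exists (4 * D) => c cM.
have cE t : 0 <= t -> 3 * (normc c * t ^+ j) <= r ^+ n * t + B * t ^+ k.+1.
  move=> t0; apply: le_trans (MrB t t0).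
  by rewrite -mulrA ler_wpM2l// ler_wpM2r ?exprn_ge0.
have nE e (t : R) : normc e = 1 -> 0 <= t ->
    normc (c * (t%:C * e) ^+ j) = normc c * t ^+ j.
  by move=> e1 t0; rewrite Normc.normcM normc_ray.
have domE : contour_dom n D (fun w => cexp (c * w ^+ j) * ckernel n k b w).
  rewrite -[D]mul1r; apply: hC => // e t e1 t0; rewrite mul1r.
  apply: le_trans (normc_cexp_le _) _; rewrite ler_expR nE//.
  apply: le_trans (cE t t0); rewrite ler_peMl ?ler1n//.
  by rewrite mulr_ge0 ?normc_ge0 ?exprn_ge0.
split=> [e t e1 en t0|N].
  apply: le_trans (domE _ _ e1 en t0) _.
  by rewrite ler_wpM2r ?expR_ge0// ler_peMl// ler1n.
have [[C' hC'] <-] := contour_integral_exp_poly b c j N kn.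
have sl : ray_smooth (fun w : R[i] => c * w ^+ j).
  by apply: ray_smoothM;
    [exact: ray_smooth_cst|exact: ray_smoothX (@ray_smooth_id R)].
have sp : ray_smooth (fun w => exp_poly N (c * w ^+ j) * ckernel n k b w).
  by apply: ray_smoothM (@ray_smooth_kernel R n k b);
    exact: ray_smooth_exp_poly.
have se : ray_smooth (fun w => cexp (c * w ^+ j) * ckernel n k b w).
  by apply: ray_smoothM (@ray_smooth_kernel R n k b); exact: ray_smooth_cexp.
rewrite -mulN1r -(contour_integralZ _ sp hC').
rewrite -(contour_integralD se _ domE (contour_domZ _ hC')); last first.
  by apply: ray_smoothM => //; exact: ray_smooth_cst.
rewrite mulrCA; apply: normc_contour_integral_le.
  by apply: ray_smoothD => //; apply: ray_smoothM => //; exact: ray_smooth_cst.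
(* The integrand becomes the Taylor remainder times the kernel. The bound [exp_rem_le_geom] costs
   exp(3 |c| t^j), whence the 3 in the hypothesis. *)
have -> : (fun w => cexp (c * w ^+ j) * ckernel n k b w +
    -1 * (exp_poly N (c * w ^+ j) * ckernel n k b w)) =
    (fun w => (cexp (c * w ^+ j) - exp_poly N (c * w ^+ j)) * ckernel n k b w).
  by apply/funext => w; rewrite mulN1r mulrBl.
apply: hC => //.
move=> e t e1 t0; apply: le_trans (exp_rem_le_geom _ _) _.
by rewrite ler_wpM2l ?exprn_ge0 ?invr_ge0// ler_expR nE// cE.
Qed.

Lemma moment_rec (R : realType) n k (b : R[i]) m : (k < n)%N ->
  m.+1%:R * moment n k b m + b * (-1) ^+ k.+1 * moment n k b (m.+1 + k) +
  moment n k b (m.+1 + n) = 0.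
Proof.
move=> kn; pose f m w := w ^+ m * ckernel n k b w.
have [C0 h0] := @monomial_dom R n k b m kn.
have [C1 h1] := @monomial_dom R n k b (m.+1 + k) kn.
have [C2 h2] := @monomial_dom R n k b (m.+1 + n) kn.
have [C3 h3] := @monomial_dom R n k b m.+1 kn.
have s0 := @ray_smooth_monomial R n k b m.
have s1 := @ray_smooth_monomial R n k b (m.+1 + k).
have s2 := @ray_smooth_monomial R n k b (m.+1 + n).
have sZ c g : ray_smooth g -> ray_smooth (fun w : R[i] => c * g w).
  by move=> sg; apply: ray_smoothM => //; exact: ray_smooth_cst.
have d0 := contour_domZ m.+1%:R h0.
have d1 := contour_domZ (b * (-1) ^+ k.+1) h1.
rewrite /moment -(contour_integralZ _ s0 h0) -(contour_integralZ _ s1 h1).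
rewrite -(contour_integralD (sZ _ _ s0) (sZ _ _ s1) d0 d1).
have d01 := contour_domD d0 d1.
rewrite -(contour_integralD _ s2 d01 h2); last by apply: ray_smoothD; exact: sZ.
(* [contour_integral_derive] takes one constant for both the integrand and its primitive. *)
have dom_max (C D : R) g : contour_dom n C g -> contour_dom n (Num.max C D) g.
  move=> gC e t e1 en t0; apply: le_trans (gC _ _ e1 en t0) _.
  by rewrite ler_wpM2r ?expR_ge0// le_max lexx.
have d2 := contour_domD d01 h2.
apply: (contour_integral_derive (F := f m.+1) _ (dom_max _ C3 _ d2)).
- by apply: ray_smoothD => //; apply: ray_smoothD; exact: sZ.
- by rewrite maxC; apply: dom_max.
move=> e t; have he := cder_ray e t.
have hk := cder_cexp (cderD (cderZ (b * alpha R k) (cderX k.+1 he))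
  (cderZ (1 / n.+1%:R) (cderX n.+1 he))).
apply: cder_eq (cderM (cderX m.+1 he) hk).
(* The derivative of the exponent with respect to w is b (-1)^(k+1) w^k + w^n: the factors k+1 and
   n+1 cancel the denominators of alpha and beta. *)
rewrite /= -/(ckernel n k b (t%:C * e)) !exprD /alpha.
have : (n.+1%:R : R[i]) != 0 by rewrite pnatr_eq0.
have : (k.+1%:R : R[i]) != 0 by rewrite pnatr_eq0.
move: (n.+1%:R : R[i]) (k.+1%:R : R[i]) (m.+1%:R : R[i]) => u v x v0 u0.
rewrite !exprS; move: (ckernel n k b (t%:C * e)) (t%:C * e) => K y.
by move: (y ^+ m) (y ^+ k) (y ^+ n) ((-1) ^+ k) => ym yk yn s; field;
  rewrite v0 u0.
Qed.

Lemma le_of_geometric (R : realType) (x y C : R) :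
  (forall N, x <= y + 2^-1 ^+ N * C) -> x <= y.
Proof.
move=> xC; rewrite -[y]addr0 -(mul0r C).
apply: (@cvgr_to_ge _ \oo _ R (fun N : nat => y + 2^-1 ^+ N * C)).
- apply: cvgD; first exact: cvg_cst.
  apply: cvgM; last exact: cvg_cst.
  by apply: cvg_expr; rewrite ger0_norm ?invr_ge0// invf_lt1 ?ltr1n.
- by near=> N.
Unshelve. all: by end_near. Qed.

(** On both rays the exponential is the positive function [G], so each ray integral is [I] times the
    direction of the ray, and the difference has imaginary part 2 I sin(pi/(n+1)) > 0. *)
Lemma contour_integral_kernel0 (R : realType) n : (1 < n)%N ->
  contour_integral n (fun w : R[i] => cexp (1 / n.+1%:R * w ^+ n.+1)) <> 0.
Proof.
move=> n1 /(congr1 (@complex.Im R)); rewrite contour_integralE.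
pose G (t : R) := expR (- (t ^+ n.+1 / n.+1%:R)).
have dP (t : R) : is_derive t 1 (fun t : R => - (t ^+ n.+1 / n.+1%:R))
  (- t ^+ n).
  rewrite (_ : (fun _ => _) = (- n.+1%:R^-1) *: (id ^+ n.+1 : R -> R));
    last first.
    apply/funext => s; transitivity (- n.+1%:R^-1 * s ^+ n.+1).
      by rewrite mulNr mulrC.
    by rewrite -[RHS]/(- n.+1%:R^-1 * (id ^+ n.+1 : R -> R) s) fctE.
  apply: is_derive_eq; rewrite /GRing.scale/= mulr1.
  by rewrite -mulr_natl mulrA mulNr mulVf ?pnatr_eq0// mulN1r.
have cG : continuous G.
  by apply: derivable_continuous => t;
    exact: (is_derive1_comp (is_derive_expR _) (dP t)).
(* With rho = 0 and B = 0 the estimate reduces to G(t) <= exp(C - t). *)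
have [C hC] := @exponent_growth R n 0 0 (ltnW n1) (lexx 0).
have Gdom : exp_dom (expR C) G.
  move=> t t0; rewrite ger0_norm ?expR_ge0// -expRD ler_expR.
  have := hC 0 t (lexx 0) t0.
  by rewrite !expr0n/= (gtn_eqF (ltnW n1)) !(mul0r, mulr0, addr0, add0r).
set I := \int[lebesgue_measure]_(t in `[0, +oo[%classic) G t.
have I0 : 0 < I.
  have iG := integrable_exp_dom cG Gdom.
  rewrite /I /Rintegral -lte_fin fineK; last exact: integrable_fin_num.
  have mG : measurable_fun `[(0 : R), +oo[%classic (EFin \o G).
    by apply/measurable_EFinP/measurable_funTS;
      exact: continuous_measurable_fun.
  (* On [0, 1] the exponent of [G] is at least -1, so this interval alone contributes at least
     exp(-1). *)
  apply: (@lt_le_trans _ _ (expR (-1))%:E); first by rewrite lte_fin expR_gt0.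
  pose A : set R := `[0, 1]%classic.
  have h1 : ((expR (-1)%R)%:E <= \int[lebesgue_measure]_(t in A) (G t)%:E)%E.
    have h2 : ((expR (-1)%R)%:E <= \int[lebesgue_measure]_(t in A)
      (expR (-1)%R)%:E)%E.
      rewrite integral_cst; last exact: measurable_itv.
      rewrite [X in (_ * X)%E](_ : _ = 1%E) ?mule1//.
      by rewrite [LHS](lebesgue_measure_itv (`[0, 1] : interval R))/= lte_fin
        ltr01 oppr0 adde0.
    apply: (le_trans h2); apply: ge0_le_integral => //.
    - exact: measurable_itv.
    - by apply/measurable_EFinP/measurable_funTS;
      exact: continuous_measurable_fun.
    - move=> t; rewrite /A/= in_itv/= => /andP[t0 t1];
      rewrite lee_fin ler_expR lerN2.
      by rewrite ler_pdivrMr// mul1r (le_trans (exprn_ile1 _ t0 t1))// ler1n.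
  apply: (le_trans h1); apply: ge0_subset_integral => //.
    exact: measurable_itv.
  by move=> t _; rewrite lee_fin expR_ge0.
  by move=> t; rewrite /A/= !in_itv/= => /andP[-> _].
pose g (w : R[i]) := cexp (1 / n.+1%:R * w ^+ n.+1).
have H s : Im (half_line_integral (ray_pull n g s)) = I * Im (ray_dir R n s).
  rewrite -RintegralZr//; last exact: integrable_exp_dom cG Gdom.
  transitivity (\int[lebesgue_measure]_(t in `[0, +oo[%classic)
      Im (ray_pull n g s t)); first by [].
  apply: eq_Rintegral => t _; rewrite /G /ray_pull /g.
  rewrite exprMn ray_dirX mulrN1 mulrN div1r natrC.
  rewrite -(rmorphXn (real_complex R)) -(fmorphV (real_complex R)).
  rewrite -(rmorphM (real_complex R)) -(rmorphN (real_complex R)) cImM.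
  rewrite [_^-1 * _]mulrC /cexp /= sin0 cos0 !(mulr0, mul0r, addr0, mulr1).
  by rewrite subr0.
rewrite cImD cImN !H /ray_dir /cexp !cImM/= expR0 expr0 expr1 mulN1r mul1r.
rewrite !mul0r !addr0 !mul1r sinN mulrN opprK => /eqP.
have s0 : 0 < sin (pi / n.+1%:R : R).
  rewrite sin_gt0_pi// divr_gt0 ?pi_gt0//= ltr_pdivrMr// ltr_pMr ?pi_gt0//.
  by rewrite ltr1n ltnS ltnW.
by rewrite gt_eqF// addr_gt0// mulr_gt0.
Qed.

(** If all moments vanished, the Taylor sums of exp(c w^(k+1)) with c = -b alpha would integrate to
    0 against the kernel, and so would their limit; but exp(c w^(k+1)) times the kernel is
    exp(w^(n+1)/(n+1)). *)
Lemma moment_neq0 (R : realType) n k (b : R[i]) : (0 < k)%N -> (k < n)%N ->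
  exists m, moment n k b m != 0.
Proof.
move=> k0 kn; apply/not_existsP => m0.
have {}m0 m : moment n k b m = 0.
  by apply/eqP; rewrite -[_ == 0]negbK; apply/negP; exact: m0.
pose c := - (b * alpha R k).
(* The whole growth 3 |c| t^(k+1) goes into the [B] term, so [r] is 0. *)
have [|||C hC] := @contour_integral_exp_approx R n k b k.+1 (normc c) 0
  (3 * normc c) kn.
- by [].
- by rewrite mulr_ge0 ?normc_ge0.
- by move=> t t0; rewrite lerDr mulr_ge0 ?exprn_ge0.
have [_ hN] := hC c (lexx _).
apply: (@contour_integral_kernel0 R n (leq_ltn_trans k0 kn)).
apply: Normc.eq0_normc; apply/eqP; rewrite eq_le normc_ge0 andbT.
apply: (@le_of_geometric _ _ _ C) => N; rewrite add0r.
apply: le_trans (hN N); rewrite [X in _ - X]big1 => [|i _];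
  last by rewrite m0 mulr0.
rewrite subr0 le_eqVlt; apply/orP; left; apply/eqP;
  congr (normc (contour_integral n _)).
apply/funext => w; rewrite /ckernel -cexpD; congr cexp.
by rewrite addrA /c mulNr addNr add0r.
Qed.

Lemma normc_moment_le (R : realType) n k (b : R[i]) m : (k < n)%N ->
  m.+1%:R * normc (moment n k b m) <=
  normc b * normc (moment n k b (m.+1 + k)) + normc (moment n k b (m.+1 + n)).
Proof.
move=> kn; have /eqP := moment_rec b m kn; rewrite -addrA addr_eq0 => /eqP h.
rewrite -[m.+1%:R](normc_nat R) -Normc.normcM h normcN.
apply: le_trans (le_normcD _ _) _.
rewrite !Normc.normcM normcX normcN Normc.normc1 expr1n mulr1.
exact: lexx.
Qed.

(** * Analyticity and growth *)

Lemma derivable_quadratic (R : realType) (f : R[i] -> R[i]) (z D : R[i])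
    (C : R) :
  (forall h, normc h <= 1 -> normc (f (h + z) - f z - h * D) <=
    normc h ^+ 2 * C) ->
  derivable (f : R[i]^o -> R[i]^o) z 1.
Proof.
move=> fC; apply: (@cvgP _ _ (D : R[i]^o)).
apply/cvgrPdist_le => e e0.
(* A positive element of [R[i]] is real, so the tolerance can be compared with moduli. *)
have /andP[/eqP Ie0 Re0] : (Im e == 0) && (0 < Re e) by move: e0; rewrite ltcE.
have eE : e = (Re e)%:C by apply: complex_ext.
have C1 : 0 < `|C| + 1 by rewrite ltr_wpDl.
(* The bound 1 gives access to the hypothesis on h; the 1 added to |C| keeps the denominator
   positive. *)
pose d : R := Num.min 1 (Re e / (`|C| + 1)).
have d0 : 0 < d by rewrite lt_min ltr01 divr_gt0.
near=> h.
have h0 : h != 0 by near: h; exact: nbhs_dnbhs_neq.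
have hd : normc h < d.
  rewrite -ltcR; change (`|h| < d%:C).
  by near: h; apply: dnbhs0_lt; rewrite ltcR.
have nh0 : 0 < normc h.
  by rewrite lt_def normc_ge0 andbT;
    apply: contra h0 => /eqP/Normc.eq0_normc ->.
rewrite eE; change ((normc (D - h^-1 * (f (h * 1 + z) - f z)))%:C <= (Re e)%:C).
rewrite lecR mulr1.
have -> : D - h^-1 * (f (h + z) - f z) = - h^-1 * (f (h + z) - f z - h * D).
  by field.
rewrite Normc.normcM normcN Normc.normcV -ler_pdivlMl ?invr_gt0// invrK.
move: hd; rewrite lt_min => /andP[/ltW h1 h2].
apply: le_trans (fC h h1) _; rewrite expr2 -mulrA ler_wpM2l ?normc_ge0//.
apply: (@le_trans _ _ (normc h * (`|C| + 1))).
  by rewrite ler_wpM2l ?normc_ge0// (le_trans (ler_norm _))// lerDl.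
by rewrite -ler_pdivlMr// ltW.
Unshelve. all: by end_near. Qed.

Lemma ray_smooth_linear (R : realType) (c : R[i]) : ray_smooth (fun w => c * w).
Proof. by apply: ray_smoothM; [exact: ray_smooth_cst|exact: ray_smooth_id]. Qed.

Lemma ler_expn (R : realType) (x : R) n : 1 <= x -> (0 < n)%N -> x <= x ^+ n.
Proof.
move=> x1; case: n => // n _.
by rewrite exprS ler_peMr ?exprn_ege1// (le_trans ler01).
Qed.

Lemma normc_linear_ray (R : realType) (c e : R[i]) t : normc e = 1 -> 0 <= t ->
  normc (c * (t%:C * e)) = normc c * t.
Proof. by move=> e1 t0; rewrite Normc.normcM -[t%:C * e]expr1 normc_ray. Qed.

(** Differentiation under the integral sign: D is the integral of -w exp(-zw) times the kernel, and
    the remainder exp(-hw) - 1 + hw is at most |h|^2 (t^2/2) exp(|h| t) in modulus. *)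
Lemma transform_quadratic (R : realType) n k (b z : R[i]) : (k < n)%N ->
  exists D C, forall h, normc h <= 1 ->
    normc (transform n k b (h + z) - transform n k b z - h * D) <=
      normc h ^+ 2 * C.
Proof.
move=> kn; have n0 : (0 < n)%N := leq_ltn_trans (leq0n k) kn.
have [C [C0 hC]] := kernel_dom b kn (lexx 0).
(* One unit of the 2 absorbs t^2/2, the other exp(|h| t) with |h| <= 1. Since r <= r^n, this [r] can
   serve as [rho] in [kernel_dom]. *)
pose r := normc z + 2.
have r1 : 1 <= r by have := normc_ge0 z; rewrite /r; lra.
have r0 : 0 <= r by exact: le_trans r1.
have rn : r <= r ^+ n by exact: ler_expn.
have sk := @ray_smooth_kernel R n k b.
pose f z w := cexp (- z * w) * ckernel n k b w.
pose g w := - w * cexp (- z * w) * ckernel n k b w.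
have sf u : ray_smooth (f u).
  by apply: ray_smoothM => //; apply: ray_smooth_cexp; exact: ray_smooth_linear.
have sg : ray_smooth g.
  apply: ray_smoothM => //; apply: ray_smoothM.
    rewrite (_ : -%R = fun w => (-1) * w); last by apply/funext => w;
      rewrite mulN1r.
    exact: ray_smooth_linear.
  by apply: ray_smooth_cexp; exact: ray_smooth_linear.
pose E := expR (4 * n.+1%:R * r ^+ n.+1).
have fdom u : normc u <= r -> contour_dom n (1 * (C * E)) (f u).
  move=> ur; apply: hC => // e t e1 t0; rewrite mul1r.
  apply: le_trans (normc_cexp_le _) _;
    rewrite ler_expR normc_linear_ray// normcN.
  by rewrite mul0r addr0 ler_wpM2r// (le_trans ur).
have gdom : contour_dom n (1 * (C * E)) g.
  apply: hC => // e t e1 t0; rewrite mul1r Normc.normcM normcN.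
  rewrite -[t%:C * e]expr1 normc_ray// expr1 mul0r addr0.
  apply: (@le_trans _ _ (expR t * expR (normc z * t))).
    rewrite ler_pM ?normc_ge0//.
      by apply: le_trans (expR_ge1Dx _); rewrite lerDr.
    apply: le_trans (normc_cexp_le _) _.
    by rewrite ler_expR normc_linear_ray// normcN.
  rewrite -expRD ler_expR -[X in X + _]mul1r -mulrDl ler_wpM2r//.
  by apply: le_trans rn; rewrite /r; lra.
exists (contour_integral n g), (4 * (C * E)) => h h1.
have hzr : normc (h + z) <= r.
  by apply: le_trans (le_normcD _ _) _; rewrite /r; lra.
have zr : normc z <= r by rewrite /r; lra.
have sZ c q : ray_smooth q -> ray_smooth (fun w : R[i] => c * q w).
  by move=> sq; apply: ray_smoothM => //; exact: ray_smooth_cst.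
have d1 := contour_domZ (-1) (fdom _ zr).
have d2 := contour_domZ (- h) gdom.
rewrite /transform -/(f _) -/(f z) -[- contour_integral n (f z)]mulN1r.
rewrite -mulNr -(contour_integralZ _ sg gdom)
  -(contour_integralZ _ (sf z) (fdom _ zr)).
rewrite -(contour_integralD (sf _) (sZ _ _ (sf z)) (fdom _ hzr) d1).
rewrite -(contour_integralD _ (sZ _ _ sg) (contour_domD (fdom _ hzr) d1) d2);
  last first.
  by apply: ray_smoothD => //; exact: sZ.
rewrite mulrCA; apply: normc_contour_integral_le.
  by apply: ray_smoothD; [apply: ray_smoothD => //; exact: sZ|exact: sZ].
have -> : (fun w => f (h + z) w + -1 * f z w + - h * g w) =
    (fun w => cexp (- z * w) * (cexp (- h * w) - exp_poly 2 (- h * w)) *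
      ckernel n k b w).
  apply/funext => w; rewrite /f /g !exp_polyS exp_poly0 add0r expr0 expr1 divr1.
  rewrite (_ : 1`! = 1)%N// divr1 opprD mulrDl cexpD.
  by move: (cexp _) (cexp _) (ckernel _ _ _ _) => x y K; ring.
apply: hC => // [|e t e1 t0]; first by rewrite exprn_ge0// normc_ge0.
rewrite mul0r addr0 Normc.normcM.
apply: (@le_trans _ _ (expR (normc z * t) * (normc h ^+ 2 * expR t * expR t))).
  rewrite ler_pM ?normc_ge0//.
    apply: le_trans (normc_cexp_le _) _.
    by rewrite ler_expR normc_linear_ray// normcN.
  apply: le_trans (exp_rem_le _ _) _; rewrite normc_linear_ray// normcN exprMn.
  rewrite ler_pM ?expR_ge0 ?divr_ge0 ?mulr_ge0 ?exprn_ge0 ?normc_ge0//.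
    by rewrite -mulrA ler_wpM2l ?exprn_ge0 ?normc_ge0// pow_fact_le_expR.
  by rewrite ler_expR ler_piMl.
rewrite mulrCA -!mulrA !ler_wpM2l ?exprn_ge0 ?normc_ge0// -!expRD ler_expR.
apply: (@le_trans _ _ (r * t)); last by rewrite ler_wpM2r.
by rewrite /r mulrDl; lra.
Qed.

Lemma phi_entire (R : realType) n k (b : R[i]) : (k < n)%N ->
  entire (phi n k b).
Proof.
move=> kn z; have [D [C hC]] := transform_quadratic b z kn.
set c := inv_2ipi R.
apply: (@derivable_quadratic _ _ _ (c * D) (normc c * C)) => h h1.
rewrite !phiE -/c -mulrBr mulrCA -mulrBr Normc.normcM mulrCA.
by rewrite ler_wpM2l ?normc_ge0// hC.
Qed.

(** Writing |z| = rho^n turns |z|^(1+1/n) into the natural power rho^(n+1). *)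
Lemma transform_growth (R : realType) n k (b : R[i]) : (k < n)%N ->
  exists C, 0 <= C /\ forall rho z, 0 <= rho -> normc z = rho ^+ n ->
    normc (transform n k b z) <= C * expR (4 * n.+1%:R * rho ^+ n.+1).
Proof.
move=> kn; have [C [C0 hC]] := kernel_dom b kn (lexx 0).
exists (4 * C); split=> [|rho z r0 zr]; first by rewrite mulr_ge0.
rewrite -mulrA; apply: normc_contour_integral_le.
  apply: ray_smoothM; last exact: ray_smooth_kernel.
  by apply: ray_smooth_cexp; exact: ray_smooth_linear.
rewrite -[C * _]mul1r; apply: hC => // e t e1 t0.
rewrite mul1r mul0r addr0 -zr; apply: le_trans (normc_cexp_le _) _.
by rewrite ler_expR normc_linear_ray// normcN.
Qed.

(** * Cauchy's estimates *)

Definition unity_root (R : realType) N : R[i] := cexp ((2 * pi / N%:R : R) *i).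

Lemma cexp_imagX (R : realType) (x : R) m :
  cexp (x *i) ^+ m = cexp ((m%:R * x) *i).
Proof.
rewrite -cexpMn; congr cexp; rewrite -[LHS]mulr_natl natrC.
by apply: complex_ext; rewrite ?(cReM, cImM)/= !(mul0r, mulr0, subrr, addr0).
Qed.

Lemma unity_rootX (R : realType) N : (0 < N)%N -> unity_root R N ^+ N = 1.
Proof.
move=> N0; rewrite /unity_root cexp_imagX mulrC divfK ?pnatr_eq0 -?lt0n//.
rewrite /cexp/= expR0 mul1r mulr_natl cos2pi sin2pi.
by [].
Qed.

(** The power is the square of exp(i pi d / N), which has positive imaginary part and so is neither
    1 nor -1. *)
Lemma unity_root_neq1 (R : realType) N d : (0 < d)%N -> (d < N)%N ->
  unity_root R N ^+ d != 1.
Proof.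
move=> d0 dN; have N0 : (0 < N)%N := leq_ltn_trans (leq0n d) dN.
have -> : unity_root R N ^+ d = cexp ((d%:R * pi / N%:R : R) *i) ^+ 2.
  by rewrite /unity_root !cexp_imagX; congr (cexp (_ *i)); ring.
rewrite sqrf_eq1 negb_or.
have s0 : 0 < Im (cexp ((d%:R * pi / N%:R : R) *i)).
  rewrite /cexp cImM /= expR0 mul1r mul0r addr0 sin_gt0_pi//.
  rewrite divr_gt0 ?mulr_gt0 ?pi_gt0 ?ltr0n//=.
  by rewrite ltr_pdivrMr ?ltr0n// mulrC ltr_pM2l ?pi_gt0// ltr_nat.
have I1 : Im (1 : R[i]) = 0 by [].
by apply/andP; split; apply: contraTneq s0 => ->; rewrite ?cImN I1 ?oppr0 ltxx.
Qed.

Lemma sum_unity_root (R : realType) N d : (0 < N)%N ->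
  \sum_(j < N) (unity_root R N ^+ d) ^+ j = if (N %| d)%N then N%:R else 0.
Proof.
move=> N0; case: ifPn => [/dvdnP[q ->]|Nd].
  rewrite mulnC exprM unity_rootX// expr1n.
  under eq_bigr do rewrite expr1n.
  by rewrite sumr_const card_ord.
have h : unity_root R N ^+ d != 1.
  rewrite (divn_eq d N) exprD mulnC exprM unity_rootX// expr1n mul1r.
  by rewrite unity_root_neq1 ?ltn_mod// lt0n.
have := subrX1 (unity_root R N ^+ d) N.
rewrite exprAC unity_rootX// expr1n subrr => /esym/eqP.
by rewrite mulf_eq0 subr_eq0 (negbTE h) => /eqP.
Qed.

(* Average over the [N]-th roots of unity. *)
Lemma cauchy_poly (R : realType) (a : nat -> R[i]) (r M : R) N m :
  0 <= r -> (m < N)%N ->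
  (forall z, normc z = r -> normc (\sum_(i < N) a i * z ^+ i) <= M) ->
  normc (a m) * r ^+ m <= M.
Proof.
move=> r0 mN aM; have N0 : (0 < N)%N := leq_ltn_trans (leq0n m) mN.
pose w := unity_root R N.
have w1 j : normc (w ^+ j) = 1 by rewrite normcX normc_cexp_imag expr1n.
have key : N%:R * (a m * r%:C ^+ m) =
    \sum_(j < N) (w ^+ (N - m)) ^+ j *
      (\sum_(i < N) a i * (r%:C * w ^+ j) ^+ i).
  (* After exchanging the sums, the sum over j vanishes unless N divides N - m + i. This number lies
     strictly between 0 and 2N, so only i = m remains. *)
  transitivity (\sum_(i < N) a i * r%:C ^+ i *
    (\sum_(j < N) (w ^+ (N - m + i)) ^+ j)).
    rewrite (bigD1 (Ordinal mN))//= sum_unity_root// subnK ?(ltnW mN)// dvdnn.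
    rewrite big1; first by rewrite addr0 mulrC.
    move=> i im; rewrite sum_unity_root// ifN ?mulr0//.
    have iN := ltn_ord i; have {im} : (i : nat) != m by [].
    by apply: contra => /dvdnP[[|[|q]]]; rewrite ?mulSn; lia.
  under eq_bigr do rewrite mulr_sumr.
  rewrite exchange_big/=; apply: eq_bigr => j _.
  rewrite mulr_sumr; apply: eq_bigr => i _.
  rewrite [in LHS]exprD [in LHS]exprMn [(r%:C * _) ^+ _]exprMn
    [(w ^+ j) ^+ i]exprAC.
  by ring.
have : normc (N%:R * (a m * r%:C ^+ m)) <= N%:R * M.
  rewrite key; apply: le_trans (normc_sum _) _.
  apply: (@le_trans _ _ (\sum_(j < N) M)).
    apply: ler_sum => j _; rewrite Normc.normcM -exprM w1 mul1r aM//.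
    by rewrite Normc.normcM w1 mulr1 normc_real ger0_norm.
  by rewrite sumr_const card_ord mulr_natl.
rewrite !Normc.normcM normc_nat normcX normc_real ger0_norm// ler_pM2l ?ltr0n//.
Qed.

(** The m-th Taylor coefficient of [transform] is (-1)^m / m! times the m-th moment. The estimate
    for polynomials is applied to Taylor sums, whose error on the circle is geometrically small. *)
Lemma moment_cauchy (R : realType) n k (b : R[i]) (r M : R) m :
  (k < n)%N -> 0 <= r ->
  (forall z, normc z = r -> normc (transform n k b z) <= M) ->
  normc (moment n k b m) / m`!%:R * r ^+ m <= M.
Proof.
move=> kn r0 hM; have n0 : (0 < n)%N := leq_ltn_trans (leq0n k) kn.
(* For j = 1 the hypothesis asks for 3 r t <= (3r + 1)^n t; the added 1 makes the base at least
   1. *)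
have [|||C hC] := @contour_integral_exp_approx R n k b 1 r (3 * r + 1) 0 kn.
- by rewrite addr_ge0 ?mulr_ge0.
- by [].
- move=> t t0; rewrite mul0r addr0 expr1 ler_wpM2r//.
  apply: le_trans (ler_expn _ n0); first by rewrite lerDl.
  by rewrite lerDr mulr_ge0.
apply: (@le_of_geometric _ _ _ (`|C|)) => N.
(* Large enough to reach the m-th coefficient and to have 2^-P <= 2^-N. *)
pose P := (N + m).+1.
have mP : (m < P)%N by rewrite ltnS leq_addl.
have -> : normc (moment n k b m) / m`!%:R =
  normc ((-1) ^+ m / m`!%:R * moment n k b m).
  by rewrite !Normc.normcM Normc.normcV normc_nat normcX normcN Normc.normc1
    expr1n mul1r mulrC.
have h := @cauchy_poly R (fun i => (-1) ^+ i / i`!%:R * moment n k b i) r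
   (M + 2^-1 ^+ P * `|C|) P m r0 mP.
apply: le_trans (h _) _.
  move=> z zr; have [|_ hz] := hC (- z); first by rewrite normcN zr.
  have -> : \sum_(i < P) (-1) ^+ i / i`!%:R * moment n k b i * z ^+ i =
     \sum_(i < P) (- z) ^+ i / i`!%:R * moment n k b (1 * i).
    by apply: eq_bigr => i _; rewrite mul1n [(- z) ^+ _]exprNn; ring.
  set T := \sum_(i < P) _.
  have -> : T = transform n k b z - (transform n k b z - T) by rewrite subKr.
  apply: le_trans (le_normcD _ _) _; rewrite normcN lerD ?hM//.
  have := hz P; rewrite /transform.
  under [X in contour_integral n X]eq_fun do rewrite expr1.
  move=> /le_trans; apply; by rewrite ler_wpM2l ?exprn_ge0 ?invr_ge0// ler_norm.
rewrite lerD2l ler_wpM2r// ler_wiXn2l ?invr_ge0// ?invf_le1 ?ler1n//.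
by rewrite /P; lia.
Qed.

(** From m0 on each use of the recurrence gains a factor 1/2, so q m <= 2^-N K w m for every N and q
    vanishes there. The recurrence then carries the zeros down to the smaller indices. *)
Lemma backward_zero (R : realType) (q w A B : nat -> R) (K : R) n k m0 :
  (forall m, 0 <= q m) -> (forall m, 0 <= A m) -> (forall m, 0 <= B m) ->
    0 <= K ->
  (forall m, (m0 <= m)%N -> q m <= K * w m) ->
  (forall m, q m <= A m * q (m.+1 + n) + B m * q (m.+1 + k)) ->
  (forall m, (m0 <= m)%N -> A m * w (m.+1 + n) + B m * w (m.+1 + k) <=
    2^-1 * w m) ->
  forall m, q m = 0.
Proof.
move=> q0 A0 B0 K0 qw qrec wrec.
have decay N m : (m0 <= m)%N -> q m <= 2^-1 ^+ N * K * w m.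
  elim: N m => [|N IH] m mm; first by rewrite expr0 mul1r qw.
  apply: le_trans (qrec m) _.
  have -> : 2^-1 ^+ N.+1 * K * w m = 2^-1 ^+ N * K * (2^-1 * w m).
    by rewrite exprSr; ring.
  have c0 : 0 <= 2^-1 ^+ N * K by rewrite mulr_ge0 ?exprn_ge0 ?invr_ge0.
  apply: le_trans (ler_wpM2l c0 (wrec m mm)).
  by rewrite mulrDr lerD// mulrCA ler_wpM2l// IH//; lia.
have q_far m : (m0 <= m)%N -> q m = 0.
  move=> mm; apply/eqP; rewrite eq_le q0 andbT.
  apply: (@le_of_geometric _ _ _ (K * w m)) => N.
  by rewrite add0r mulrA decay.
(* [d] bounds how far m lies below m0; the recurrence refers only to larger indices. *)
suff H d m : (m0 <= m + d)%N -> q m = 0 by move=> m; apply: (H m0); lia.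
elim: d m => [|d IH] m mm; first by apply: q_far; rewrite -(addn0 m).
apply/eqP; rewrite eq_le q0 andbT; apply: le_trans (qrec m) _.
by rewrite !IH ?mulr0 ?addr0//; lia.
Qed.

(** * The order of growth *)

(** Each of the d factors m+1, ..., m+d is at most m+d. This adjusts the factorials when the
    recurrence is written for Taylor coefficients. *)
Lemma fact_addn_le m d : ((m + d)`! <= m`! * (m + d) ^ d)%N.
Proof.
elim: d => [|d IH]; first by rewrite addn0 expn0 muln1.
rewrite addnS factS expnS [leqRHS]mulnCA leq_mul2l; apply/orP; right.
apply: leq_trans IH _; rewrite leq_mul2l; apply/orP; right.
by case: d => // d; rewrite leq_exp2r.
Qed.

Lemma eventually_ln_ge (R : realType) (L : R) :
  exists m0, (0 < m0)%N /\ forall m, (m0 <= m)%N -> L <= ln m%:R.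
Proof.
have [m0 hm] : exists m0, expR L <= m0%:R.
  by exists (Num.bound (expR L)); rewrite ltW// archi_boundP// expR_ge0.
exists m0.+1; split=> // m mm.
have m0' : 0 < (m%:R : R) by rewrite ltr0n; lia.
rewrite -[L]expRK ler_ln ?posrE ?expR_gt0//.
by apply: le_trans hm _; rewrite ler_nat; lia.
Qed.

(** With M = m+1+j, split tau M as tau m + tau (j+1) and use ln m <= ln M. The gain over the weight
    m^(-tau m) is M^(-(tau (j+1) - j)), which is small for large m when tau (j+1) > j. *)
Lemma weight_ratio_le (R : realType) (tau : R) j m : (0 < m)%N -> 0 <= tau ->
  (m.+1 + j)%:R ^+ j * expR (- tau * (m.+1 + j)%:R * ln (m.+1 + j)%:R) <=
  expR (- (tau * j.+1%:R - j%:R) * ln (m.+1 + j)%:R) *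
  expR (- tau * m%:R * ln m%:R) :> R.
Proof.
move=> m0 t0; set M := (m.+1 + j)%N.
have M0 : 0 < (M%:R : R) by rewrite ltr0n.
rewrite -{1}[M%:R](lnK M0) -expRM_natl -!expRD ler_expR.
have mE : (M%:R : R) = m%:R + j.+1%:R by rewrite -natrD /M addSnnS.
have lnm : ln (m%:R : R) <= ln M%:R.
  by rewrite ler_ln ?posrE ?ltr0n// ler_nat /M; lia.
have : tau * m%:R * ln (m%:R : R) <= tau * m%:R * ln M%:R.
  by rewrite ler_wpM2l// mulr_ge0.
move: lnm => _; move: (ln M%:R) (ln m%:R) => x y; rewrite mE.
by move: (j.+1%:R : R) (m%:R : R) => u v h; lra.
Qed.

(** Here s is ln |z|, so the excluded bound is C exp(|z|^sigma) for large |z|. *)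
Lemma transform_lower (R : realType) n k (b : R[i]) (sigma C s0 : R) :
  (0 < k)%N -> (k < n)%N -> 0 < sigma -> sigma < 1 + 1 / n%:R ->
  ~ (forall s z, s0 <= s -> normc z = expR s ->
    normc (transform n k b z) <= C * expR (expR (sigma * s))).
Proof.
move=> k0 kn sig0 sig1 hC.
have n0 : 0 < (n%:R : R) by rewrite ltr0n; lia.
have kr0 : 0 < (k%:R : R) by rewrite ltr0n.
have knr : (k%:R : R) < n%:R by rewrite ltr_nat.
have n1 : 0 < (n%:R + 1 : R) by rewrite addr_gt0.
have isig : n%:R / (n%:R + 1) < sigma^-1.
  rewrite ltr_pdivrMr// -ltr_pdivrMl ?invr_gt0// invrK.
  rewrite -ltr_pdivlMr// mulrDl divff ?gt_eqF//.
(* The weights are [m ^ (- tau * m)]: [tau < sigma^-1] lets them dominate the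
   bounds given by Cauchy's estimates, and [n / (n + 1) < tau] makes the
   recurrence contract them. *)
pose tau := (n%:R / (n%:R + 1) + sigma^-1) / 2.
have tau1 : tau < sigma^-1 by rewrite /tau; lra.
have tau2 : n%:R / (n%:R + 1) < tau by rewrite /tau; lra.
have en : 0 < tau * n.+1%:R - n%:R.
  by rewrite subr_gt0 -natr1 -ltr_pdivrMr.
(* As x / (x + 1) is increasing, k / (k + 1) < n / (n + 1) < tau. *)
have ek : 0 < tau * k.+1%:R - k%:R.
  rewrite subr_gt0 -natr1 -ltr_pdivrMr ?addr_gt0//; apply: lt_trans tau2.
  rewrite ltr_pdivrMr ?addr_gt0// mulrAC ltr_pdivlMr//; nra.
have tau0 : 0 <= tau by rewrite ltW// (lt_trans _ tau2)// divr_gt0.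
pose b1 := normc b + 1.
have b10 : 0 < b1 by rewrite ltr_wpDl ?normc_ge0.
(* Four demands on ln m: the circle chosen below lies where the bound holds; the gap between tau and
   1/sigma absorbs exp(m); each of the two terms of the recurrence drops to a quarter of the
   weight. *)
pose L := Num.max (Num.max (sigma * s0) (sigma^-1 - tau)^-1)
  (Num.max (ln 4 / (tau * n.+1%:R - n%:R))
    (ln (4 * b1) / (tau * k.+1%:R - k%:R))).
have [m0 [m00 hL]] := @eventually_ln_ge R L.
have {hL}hL m : (m0 <= m)%N -> [/\ sigma * s0 <= ln m%:R,
    1 <= (sigma^-1 - tau) * ln m%:R,
    ln 4 <= (tau * n.+1%:R - n%:R) * ln m%:R &
    ln (4 * b1) <= (tau * k.+1%:R - k%:R) * ln m%:R].
  move=> /hL; rewrite /L !ge_max => /andP[/andP[h1 h2] /andP[h3 h4]];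
    split => //.
  - by rewrite -ler_pdivrMl ?subr_gt0// mulr1.
  - by rewrite -ler_pdivrMl// mulrC.
  - by rewrite -ler_pdivrMl// mulrC.
(* [q] is the modulus of the Taylor coefficient; [A] and [B] arise from rewriting the recurrence in
   terms of [q]. *)
pose q m := normc (moment n k b m) / m`!%:R.
pose w m : R := expR (- tau * m%:R * ln m%:R).
pose A m : R := (m.+1 + n)%:R ^+ n.
pose B m : R := normc b * (m.+1 + k)%:R ^+ k.
have [m] := moment_neq0 b k0 kn.
have q00 m' : 0 <= q m' by rewrite divr_ge0 ?normc_ge0.
have C0 : 0 <= C.
  have := hC s0 (expR s0)%:C (lexx _); rewrite normc_real ger0_norm ?expR_ge0//.
  move=> /(_ erefl) /(le_trans (normc_ge0 _)).
  by rewrite pmulr_lge0// expR_gt0.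
suff qz m' : q m' = 0.
  have /eqP := qz m; rewrite mulf_eq0 invr_eq0 pnatr_eq0.
  by rewrite (gtn_eqF (fact_gt0 m)) orbF => /eqP/Normc.eq0_normc ->;
    rewrite eqxx.
move: m'; apply: (@backward_zero R q w A B C n k m0) => //.
- by move=> m'; rewrite exprn_ge0.
- by move=> m'; rewrite mulr_ge0 ?exprn_ge0 ?normc_ge0.
- move=> m' mm; have [h1 h2 _ _] := hL _ mm.
  (* The radius R = exp(s) satisfies R^sigma = m', so Cauchy's estimate becomes q m' <= C exp(m')
     m'^(-m'/sigma). *)
  pose s := ln m'%:R / sigma.
  have ss : s0 <= s by rewrite /s ler_pdivlMr// mulrC.
  have hs : expR (sigma * s) = m'%:R.
    rewrite /s mulrCA divff ?gt_eqF// mulr1.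
    by rewrite lnK// posrE ltr0n (leq_trans m00).
  have hM z : normc z = expR s -> normc (transform n k b z) <= C * expR m'%:R.
    by move=> hz; rewrite -hs; apply: hC.
  have := moment_cauchy m' kn (expR_ge0 s) hM.
  rewrite -/(q m') -ler_pdivlMr ?exprn_gt0 ?expR_gt0// => /le_trans; apply.
  rewrite -mulrA ler_wpM2l// -expRM_natl -expRN -expRD ler_expR.
  have mr0 : 0 <= (m'%:R : R) by [].
  have := ler_wpM2l mr0 h2; rewrite /s mulr1 mulrBl mulrBr.
  move: (ln (m'%:R : R)) => x; rewrite mulrCA.
  by move: (m'%:R : R) (sigma^-1) => y z; lra.
(* The inequality between moments is divided by (m'+1)!, and [fE] replaces this factorial by the one
   belonging to each index. *)
- move=> m'; have fE d : normc (moment n k b (m'.+1 + d)) / m'.+1`!%:R <=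
      (m'.+1 + d)%:R ^+ d * q (m'.+1 + d).
    rewrite /q [leRHS]mulrCA ler_wpM2l ?normc_ge0//.
    rewrite ler_pdivlMr ?ltr0n ?fact_gt0// ler_pdivrMl ?ltr0n ?fact_gt0//.
    by rewrite -natrX -natrM ler_nat fact_addn_le.
  apply: (@le_trans _ _ (normc (moment n k b (m'.+1 + n)) / m'.+1`!%:R +
     normc b * (normc (moment n k b (m'.+1 + k)) / m'.+1`!%:R))); last first.
    by rewrite lerD ?fE// /B -mulrA ler_wpM2l ?normc_ge0 ?fE.
  rewrite mulrA -mulrDl ler_pdivlMr ?ltr0n ?fact_gt0// factS natrM.
  rewrite /q mulrCA divfK ?pnatr_eq0 ?gtn_eqF ?fact_gt0// addrC.
  exact: normc_moment_le.
- move=> m' mm; have [h1 h2 h3 h4] := hL _ mm.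
  have m'0 : (0 < m')%N by exact: leq_trans mm.
  have lnle d : ln (m'%:R : R) <= ln (m'.+1 + d)%:R.
    by rewrite ler_ln ?posrE ?ltr0n// ler_nat addSn ltnW// ltnS leq_addr.
  have wn := @weight_ratio_le R tau n m' m'0 tau0.
  have wk := @weight_ratio_le R tau k m' m'0 tau0.
  have -> : 2^-1 * w m' = 4^-1 * w m' + 4^-1 * w m' by field.
  rewrite lerD//.
    apply: le_trans wn _; rewrite ler_wpM2r ?expR_ge0// mulNr expRN.
    rewrite lef_pV2 ?posrE ?expR_gt0//.
    rewrite -[leLHS]lnK ?posrE// ler_expR (le_trans h3)// ler_wpM2l ?lnle//
      ltW//.
  rewrite -mulrA.
  (* |b| is replaced by b1 = |b| + 1, which can be divided by even if b = 0. *)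
  apply: (@le_trans _ _ (b1 * ((4 * b1)^-1 * w m'))).
    rewrite ler_pM ?normc_ge0 ?mulr_ge0 ?exprn_ge0 ?expR_ge0//.
      by rewrite /b1 lerDl.
    apply: le_trans wk _; rewrite ler_wpM2r ?expR_ge0// mulNr expRN.
    rewrite lef_pV2 ?posrE ?expR_gt0 ?mulr_gt0//.
    rewrite -[leLHS]lnK ?posrE ?mulr_gt0// ler_expR (le_trans h4)// ler_wpM2l
      ?lnle// ltW//.
  by rewrite mulrA invfM mulrCA divff ?mulr1// gt_eqF.
Qed.

(** For x <= 0 the value ln x is 0 by convention, and 0 <= y settles this case. *)
Lemma ln_le_of_expR (R : realType) (x y : R) : 0 <= y -> x <= expR y ->
  ln x <= y.
Proof.
move=> y0 xy; have [x0|x0] := ltP 0 x; last by rewrite ln0.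
by rewrite -[y]expRK ler_ln ?posrE ?expR_gt0.
Qed.

Lemma expR_ge_of_ln (R : realType) (x y : R) : ln x <= y -> x <= expR y.
Proof.
move=> xy; have [x0|x0] := ltP 0 x; last by rewrite (le_trans x0) ?expR_ge0.
by rewrite -[x]lnK ?posrE// ler_expR.
Qed.

Lemma max_modulus_le (R : realType) (f : R[i] -> R[i]) (r B : R) : 0 <= r ->
  (forall z, normc z = r -> normc (f z) <= B) -> max_modulus r f <= B.
Proof.
move=> r0 fB; apply: ge_sup.
  have rr : normc r%:C = r by rewrite normc_real ger0_norm.
  by exists (normc (f r%:C)), r%:C.
by move=> x [z /= zr <-]; exact: fB.
Qed.

(** [B] shows that the set of moduli is bounded above, so that its [sup] is a true upper bound. *)
Lemma le_max_modulus (R : realType) (f : R[i] -> R[i]) (r B : R) z :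
  (forall z, normc z = r -> normc (f z) <= B) -> normc z = r ->
  normc (f z) <= max_modulus r f.
Proof.
move=> fB zr; apply: ub_le_sup; last by exists z.
by exists B => x [u /= ur <-]; exact: fB.
Qed.

(** With s = ln |z| and rho = exp(s/n), rho^(n+1) is |z|^(1+1/n). It is at least 1, so the constant
    factors can be moved into the exponent. *)
Lemma phi_growth (R : realType) n k (b : R[i]) : (k < n)%N ->
  exists A, 1 <= A /\ forall s z, 0 <= s -> normc z = expR s ->
    normc (phi n k b z) <= expR (A * expR ((1 + 1 / n%:R) * s)).
Proof.
move=> kn; have [C [C0 hC]] := transform_growth b kn.
have n0 : (n%:R : R) != 0 by rewrite pnatr_eq0 -lt0n (leq_ltn_trans _ kn).
set c := inv_2ipi R.
pose D := normc c * C + 1.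
have D1 : 1 <= D by rewrite lerDr mulr_ge0 ?normc_ge0.
exists (ln D + 4 * n.+1%:R); split.
  by rewrite ler_wpDl ?ln_ge0// -natrM ler1n.
move=> s z s0 zs; rewrite phiE -/c Normc.normcM.
have := hC (expR (s / n%:R)) z (expR_ge0 _).
rewrite -expRM_natl mulrCA divff// mulr1 => /(_ zs).
rewrite -expRM_natl (_ : n.+1%:R * (s / n%:R) = (1 + 1 / n%:R) * s); last first.
  by rewrite -natr1; field.
set E := expR ((1 + 1 / n%:R) * s) => h.
have E1 : 1 <= E.
  by rewrite -expR0 ler_expR mulr_ge0// addr_ge0// divr_ge0.
apply: (@le_trans _ _ (D * expR (4 * n.+1%:R * E))).
  apply: le_trans (ler_wpM2l (normc_ge0 c) h) _.
  by rewrite [leLHS]mulrA ler_wpM2r ?expR_ge0// lerDl.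
have DE : D = expR (ln D) by rewrite lnK// posrE (lt_le_trans _ D1).
rewrite {1}DE -expRD ler_expR [leRHS]mulrDl lerD2r.
by rewrite ler_peMr ?ln_ge0.
Qed.

Lemma order_phi_le (R : realType) n k (b : R[i]) : (k < n)%N ->
  (order_of_growth (phi n k b) <= (1 + 1 / n%:R)%:E)%E.
Proof.
move=> kn; have [A [A1 hA]] := phi_growth b kn.
have A0 : 0 < A by exact: lt_le_trans A1.
apply/lee_addgt0Pr => e e0; rewrite /order_of_growth limf_esupE.
(* Once ln r >= ln A / e, the constant ln A is at most e ln r; the 1 keeps ln r positive. *)
pose s1 := Num.max 1 (ln A / e).
have s10 : 0 < s1 by rewrite lt_max ltr01.
apply: ge_ereal_inf; exists
  (ereal_sup [set (ln (ln (max_modulus r (phi n k b))) / ln r)%:E |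
    r in [set r | expR s1 < r]]).
  exists [set r | expR s1 < r] => //.
  by exists (expR s1); split=> //; rewrite num_real.
apply: ge_ereal_sup => _ [r /= rs1 <-].
have r0 : 0 < r by apply: lt_trans rs1; exact: expR_gt0.
have rE : r = expR (ln r) by rewrite lnK.
set s := ln r in rE *.
have ss1 : s1 <= s by rewrite -ler_expR -rE ltW.
have s0 : 0 < s by exact: lt_le_trans ss1.
rewrite -EFinD lee_fin ler_pdivrMr//.
have hM : max_modulus r (phi n k b) <= expR (A * expR ((1 + 1 / n%:R) * s)).
  apply: max_modulus_le; first exact: ltW.
  by move=> z; rewrite rE; apply: hA; exact: ltW.
have h1 : ln (max_modulus r (phi n k b)) <= A * expR ((1 + 1 / n%:R) * s).
  by apply: ln_le_of_expR hM; rewrite mulr_ge0 ?expR_ge0 ?ltW.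
apply: (@le_trans _ _ (ln A + (1 + 1 / n%:R) * s)).
  apply: ln_le_of_expR.
    by rewrite addr_ge0 ?ln_ge0// mulr_ge0 ?(ltW s0)// addr_ge0// divr_ge0.
  by rewrite expRD lnK.
rewrite [leRHS]mulrDl addrC lerD2l mulrC -ler_pdivrMr//.
by apply: le_trans ss1; rewrite le_max lexx orbT.
Qed.

(** A smaller limsup would give sigma < 1 + 1/n with ln ln M(r) <= sigma ln r for all large r, hence
    M(r) <= exp(r^sigma), which [transform_lower] excludes. *)
Lemma order_phi_ge (R : realType) n k (b : R[i]) : (0 < k)%N -> (k < n)%N ->
  ((1 + 1 / n%:R)%:E <= order_of_growth (phi n k b))%E.
Proof.
move=> k0 kn; have [A [A1 hA]] := phi_growth b kn.
rewrite leNgt; apply/negP; rewrite /order_of_growth limf_esupE.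
move=> /ereal_inf_lt[_ [V [r0 [_ Vr0]] <-] hV].
have d0 : 0 < 1 + 1 / n%:R :> R by rewrite ltr_wpDr ?divr_ge0.
have [sigma [sig0 sig1 hsig]] : exists sigma,
  [/\ 0 < sigma, sigma < 1 + 1 / n%:R &
    forall r, V r -> ln (ln (max_modulus r (phi n k b))) / ln r <= sigma].
  move: hV; set S := ereal_sup _; move: (erefl S); rewrite {1}/S.
  case: S => [x| |] hS //; rewrite ?lte_fin => hx.
  (* The midpoint between max(0, x) and 1 + 1/n is positive even when the supremum x is negative. *)
  - exists ((Num.max 0 x + (1 + 1 / n%:R)) / 2).
    have m1 : Num.max 0 x < 1 + 1 / n%:R by rewrite gt_max d0.
    have m0 : 0 <= Num.max 0 x by rewrite le_max lexx.
    split=> [| |r Vr]; [lra|lra|].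
    apply: (@le_trans _ _ x).
      by rewrite -lee_fin -hS; apply: ereal_sup_ubound; exists r.
    have : x <= Num.max 0 x by rewrite le_max lexx orbT.
    by lra.
  - exists ((1 + 1 / n%:R) / 2); split=> [| |r Vr]; [lra|lra|].
    suff : ((ln (ln (max_modulus r (phi n k b))) / ln r)%:E <= -oo)%E by [].
    by rewrite -hS; apply: ereal_sup_ubound; exists r.
pose c := inv_2ipi R.
have c0 : 0 < normc c.
  rewrite lt_def normc_ge0 andbT; apply: contra (@inv_2ipi_neq0 R) => /eqP h.
  by apply/eqP; exact: Normc.eq0_normc.
(* The threshold |r0| + 1 makes s positive and exp(s) > r0; the constant 1/|c| removes the prefactor
   of [phi]. *)
apply: (@transform_lower R n k b sigma (normc c)^-1 (`|r0| + 1) k0 kn sig0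
  sig1).
move=> s z s0 zs; have s00 : 0 < s by apply: lt_le_trans s0; rewrite ltr_wpDl.
have r0s : r0 < expR s.
  apply: le_lt_trans (ler_norm _) _; apply: lt_le_trans (expR_ge1Dx s).
  by move: s0; lra.
have := hsig _ (Vr0 _ r0s);
  rewrite expRK ler_pdivrMr// => /expR_ge_of_ln/expR_ge_of_ln hM.
rewrite ler_pdivlMl// -Normc.normcM -phiE.
apply: le_trans hM.
(* The upper bound on the growth serves once more, to bound the set of moduli. *)
apply: (le_max_modulus (B := expR (A * expR ((1 + 1 / n%:R) * s)))) => // u us.
by apply: hA => //; exact: ltW.
Qed.

Theorem theorem2 (R : realType) (n k : nat) (b : R[i]) :
  (0 < k)%N -> (k < n)%N ->
  entire (phi n k b) /\
  order_of_growth (phi n k b) = (1 + 1 / n%:R)%:E.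
Proof.
move=> k0 kn; split; first exact: phi_entire.
by apply/eqP; rewrite eq_le order_phi_le//= order_phi_ge.
Qed.
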